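(* Let $N \in \mathbb{N}^{*}$, $d_{1}, \dotsc, d_{N}, m_{1}, \dotsc, m_{N} \in \mathbb{N}$ with $d := d_1 + \dotsb + d_N \geq 1$, and $A_{i} \in \mathcal{M}_{d_{i}}(\mathbb{R})$, $B_{i} \in \mathcal{M}_{d_{i}, m_{i}}(\mathbb{R})$ for $i \in \underline{N}$, and assume that $(A_{i}, B_{i})$ is controllable for every $i \in \underline{N}$. Let $M$, $p$, $\mu_1, \dotsc, \mu_N$ be as in the context, with associated probability space $(\Omega, \mathfrak{F}, \mathbb{P})$ and random switching signal $\boldsymbol{\alpha}(\omega)$. Let $\widehat{A} \in \mathcal{M}_d(\mathbb{R})$ be the block-diagonal matrix with diagonal blocks $A_1, \dotsc, A_N$, let $\widehat{B}_i \in \mathcal{M}_{d, m_i}(\mathbb{R})$ be the block column whose $i$-th block (of size $d_i \times m_i$) is $B_i$ and whose other blocks are zero, and let $P_i \in \mathcal{M}_{d_i, d}(\mathbb{R})$ be the matrix of the canonical projection onto the $i$-th factor of $\mathbb{R}^d = \mathbb{R}^{d_1} \times \dotsb \times \mathbb{R}^{d_N}$. Then, for every $\lambda \in \mathbb{R}$, there exist matrices $K_{i} \in \mathcal{M}_{m_{i}, d_{i}}(\mathbb{R})$, $i \in \underline{N}$, such that the maximal Lyapunov exponent $\lambda_{\max}^{\mathrm{c}}$ of the closed-loop random switched system \[ \dot{x}(t) = \left( \widehat{A} + \widehat{B}_{\boldsymbol{\alpha}(\omega)(t)} K_{\boldsymbol{\alpha}(\omega)(t)} P_{\boldsymbol{\alpha}(\omega)(t)}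 \right) x(t) \] satisfies $\lambda_{\max}^{\mathrm{c}} \leq \lambda$.
   Context: Notation: $\mathbb{N}=\{0,1,2,\dots\}$, $\mathbb{N}^{*}=\{1,2,\dots\}$, $\mathbb{R}_+=[0,\infty)$, $\mathbb{R}_+^{*}=(0,\infty)$, $\underline{N}=\{1,\dots,N\}$; $\mathcal{M}_{a,b}(\mathbb{R})$ is the set of real $a\times b$ matrices and $\mathcal{M}_a=\mathcal{M}_{a,a}$. Random switching signal. $M \in \mathcal{M}_N(\mathbb{R})$ is an irreducible right-stochastic matrix (nonnegative entries, rows summing to $1$) and $p$ is its unique invariant probability row vector ($pM=p$). For each $i \in \underline{N}$, $\mu_i$ is a Borel probability measure on $\mathbb{R}_+^{*}$ (also regarded as a measure on $\mathbb{R}_+$) with finite expectation $\tau_i = \int t \, \mathrm{d}\mu_i(t) \in (0,\infty)$. Let $\Omega = (\underline{N} \times \mathbb{R}_+)^{\mathbb{N}^{*}}$ with its product $\sigma$-algebra $\mathfrak{F}$ and let $\mathbb{P}$ be the probability measure on $(\Omega,\mathfrak{F})$ determined by \[ \mathbb{P}\bigl( (\{i_1\}\times U_1) \times \dotsb \times (\{i_n\}\times U_n) \times (\underline{N}\times\mathbb{R}_+)^{\mathbb{N}^{*}\setminus\underline{n}} \bigr) = p_{i_1}\mu_{i_1}(U_1) M_{i_1 i_2}\mu_{i_2}(U_2) \dotsm M_{i_{n-1} i_n} \mu_{i_n}(U_n) \] for $n\in\mathbb{N}^{*}$, $i_1,\dots,i_n\in\underline{N}$ and Borel sets $U_1,\dots,U_n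 \subset \mathbb{R}_+$. Let $\Omega_0 = \{(i_n,t_n)_{n\ge 1} \in \Omega : \sum_{n} t_n = \infty\}$, which has $\mathbb{P}(\Omega_0)=1$. For $\omega = (i_n,t_n)_{n\ge1} \in \Omega_0$, set $s_0=0$, $s_n = \sum_{k=1}^n t_k$, and define $\boldsymbol{\alpha}(\omega):\mathbb{R}_+\to\underline{N}$ by $\boldsymbol{\alpha}(\omega)(t) = i_n$ for $t\in[s_{n-1},s_n)$, $n \in \mathbb{N}^{*}$. Maximal Lyapunov exponent. For a random switched system $\dot x(t) = L_{\boldsymbol{\alpha}(\omega)(t)} x(t)$ with $L_1,\dots,L_N \in \mathcal{M}_d(\mathbb{R})$, let $\varphi_{\mathrm{rc}}(t;x_0,\omega)$ be the value at time $t$ of the (continuous) solution with $x(0)=x_0$, and for $x_0 \neq 0$ let $\lambda_{\mathrm{rc}}(x_0,\omega) = \limsup_{t\to\infty} \frac1t \log\|\varphi_{\mathrm{rc}}(t;x_0,\omega)\|$. By the Multiplicative Ergodic Theorem, for almost every $\omega$ the function $x_0\mapsto\lambda_{\mathrm{rc}}(x_0,\omega)$ takes finitely many values on $\mathbb{R}^d\setminus\{0\}$, and the set of these values does not depend on $\omega$; $\lambda_{\max}^{\mathrm{c}}$ denotes the largest of them. *)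

(* Defs.v *)
From HB Require Import structures.
From mathcomp Require Import all_boot all_order all_algebra.
From mathcomp Require Import all_classical all_reals all_analysis.

Set Implicit Arguments.
Unset Strict Implicit.
Unset Printing Implicit Defensive.

Import Order.TTheory GRing.Theory Num.Theory numFieldNormedType.Exports.

Local Open Scope classical_set_scope.
Local Open Scope ring_scope.

(* The number of modes is at least 1, so it is written N.+1 throughout. *)
HB.instance Definition _ (n : nat) := isPointed.Build 'I_n.+1 ord0.

Section markov.
Context {R : realType} {n : nat}.

Definition right_stochastic (M : 'M[R]_n) : Prop :=
  (forall i j, 0 <= M i j) /\ (forall i, \sum_j M i j = 1).

Definition irreducible_mx (M : 'M[R]_n) : Prop :=
  forall i j, exists k : nat, 0 < (M ^+ k) i j.

Definition invariant_probability (M : 'M[R]_n) (p : 'rV[R]_n) : Prop :=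
  [/\ forall i, 0 <= p 0 i, \sum_i p 0 i = 1 & p *m M = p].

End markov.

Section switching_paths.
Context {R : realType} {N : nat}.

(* w k is the pair (i_{k+1}, t_{k+1}): indices start at 0 instead of 1.  The
   durations range over R instead of R_+; nonnegativity is part of [Omega0],
   and the laws mu_i of the durations are concentrated on ]0, +oo[. *)
Definition switching_path := nat -> 'I_N.+1 * R.

Definition cylinder (n : nat) (i : nat -> 'I_N.+1) (U : nat -> set R) :
    set switching_path :=
  [set w | forall k, (k < n)%N -> (w k).1 = i k /\ U k (w k).2].

Definition cylinders : set (set switching_path) :=
  [set C | exists n i U, (forall k, measurable (U k)) /\ C = cylinder n i U].

(* the space of switching paths with its product sigma-algebra *)
Definition Omega : measurableType (cylinders.-sigma) :=
  g_sigma_algebraType cylinders.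

Definition switching_law (M : 'M[R]_N.+1) (p : 'rV[R]_N.+1)
    (mu : 'I_N.+1 -> probability R R)
    (P : probability Omega R) : Prop :=
  forall (n : nat) (i : nat -> 'I_N.+1) (U : nat -> set R),
    (forall k, measurable (U k)) ->
    P (cylinder n.+1 i U) =
      ((p 0 (i 0%N) * \prod_(k < n) M (i k) (i k.+1))%:E *
       \prod_(k < n.+1) mu (i k) (U k))%E.

Definition switch_time (w : switching_path) (n : nat) : R := \sum_(k < n) (w k).2.

Definition Omega0 : set switching_path :=
  [set w | (forall k, 0 <= (w k).2) /\
           switch_time w n @[n --> \oo] --> +oo].

(* On [Omega0] and for t >= 0 the set below is a singleton; the first mode is
   only a default value for the other cases. *)
Definition alpha (w : switching_path) (t : R) : 'I_N.+1 :=
  xget (w 0%N).1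
    [set i | exists n,
       switch_time w n <= t < switch_time w n.+1 /\ i = (w n).1].

End switching_paths.
Arguments switching_path : clear implicits.
Arguments Omega : clear implicits.

Section trajectories.
Context {R : realType}.

(* x is absolutely continuous on [0, T] with derivative v almost everywhere *)
Definition primitive_on {n : nat} (T : R) (v x : R -> 'cV[R]_n) : Prop :=
  forall i,
    lebesgue_measure.-integrable `[0, T] (fun s => (v s i 0)%:E) /\
    forall t, 0 <= t <= T ->
      x t i 0 = x 0 i 0 + \int[lebesgue_measure]_(s in `[0, t]) v s i 0.

(* Every state can be steered to every state along x' = A x + B u, in some
   finite time and with an integrable control u. *)
Definition controllable {n m : nat} (A : 'M[R]_n) (B : 'M[R]_(n, m)) : Prop :=
  forall x0 x1 : 'cV[R]_n,
    exists (T : R) (u : R -> 'cV[R]_m) (x : R -> 'cV[R]_n),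
      [/\ 0 < T,
          forall k,
            lebesgue_measure.-integrable `[0, T] (fun s => (u s k 0)%:E),
          primitive_on T (fun s => A *m x s + B *m u s) x,
          x 0 = x0
        & x T = x1].

End trajectories.

Section lyapunov.
Context {R : realType} {N d : nat}.
Implicit Types (L : 'I_N.+1 -> 'M[R]_d) (w : switching_path R N).

(* The derivative fails to exist at the switching times, hence the integral
   form of x' = L_{alpha(w)(t)} x.  For w in [Omega0] there is exactly one
   solution, up to its irrelevant values at negative times. *)
Definition is_solution L w (x0 : 'cV[R]_d) (x : R -> 'cV[R]_d) : Prop :=
  x 0 = x0 /\
  forall T, 0 < T -> primitive_on T (fun s => L (alpha w s) *m x s) x.

Definition phi_rc L w (x0 : 'cV[R]_d) : R -> 'cV[R]_d :=
  xget (fun=> 0) [set x | is_solution L w x0 x].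

(* The norm of the library on 'cV[R]_d is the max norm; the exponent does not
   depend on the choice of a norm. *)
Definition lambda_rc L w (x0 : 'cV[R]_d) : \bar R :=
  limf_esup (fun t : R => (t^-1 * ln `|phi_rc L w x0 t|)%:E) (pinfty_nbhs R).

Definition lyapunov_values L w : set (\bar R) :=
  [set lambda_rc L w x0 | x0 in [set x0 : 'cV[R]_d | x0 != 0]].

(* l is the largest value of x0 |-> lambda_rc(x0, w), the same for almost
   every w *)
Definition is_lambda_max (P : probability (Omega R N) R) L (l : \bar R) : Prop :=
  {ae P, forall w, [/\ Omega0 w, lyapunov_values L w l
                     & ubound (lyapunov_values L w) l]}.

End lyapunov.

Section blocks.
Context {R : realType} {n : nat} {d m : 'I_n -> nat}.

(* The test j == i cannot be dropped: [conform_mx] only compares dimensions,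
   and is here used to transport B_i along the equality d j = d i. *)
Definition block_column (i : 'I_n) (Bi : 'M[R]_(d i, m i)) :
    'M[R]_(\sum_(j < n) d j, m i) :=
  \mxcol_(j < n) (if j == i then conform_mx 0 Bi else 0 : 'M[R]_(d j, m i)).

(* rows of the identity matrix in block i *)
Definition block_proj (i : 'I_n) : 'M[R]_(d i, \sum_(j < n) d j) :=
  submxcol 1%:M i.

Definition closed_loop (A : forall i, 'M[R]_(d i))
    (B : forall i, 'M[R]_(d i, m i)) (K : forall i, 'M[R]_(m i, d i))
    (i : 'I_n) : 'M[R]_(\sum_(j < n) d j) :=
  \mxdiag_(j < n) A j + block_column (B i) *m K i *m block_proj i.

End blocks.

(* Main.v *)
(* The projections of the closed loop onto the factors of R^d evolve separately:
   the j-th one follows A_j + B_j K_j while mode j is active and A_j otherwise.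
   By pole shifting the first flow is at most C g^k exp(- g t) for every large
   g, with C and k independent of g, so the logarithm of the norm of the j-th
   block is bounded along the switching times by the Birkhoff sums of an affine
   function of the current sojourn.  A jump into mode j costs only k ln g while
   the time spent there gains g per unit, hence this function, corrected by the
   target rate, has a negative mean once g is large; Garsia's argument for the
   maximal ergodic theorem then bounds its Birkhoff sums almost surely.

   The exponent itself needs no multiplicative ergodic theorem: whether all
   solutions are O(exp(c t)) is a shift-invariant event, of probability 0 or 1
   since M is irreducible, and the infimum of the rational c for which it is
   almost sure is the largest Lyapunov exponent of almost every path. *)
Require Import Defs.
From mathcomp Require Import all_boot all_order all_algebra.
From mathcomp Require Import all_classical all_reals all_analysis.
From mathcomp Require Import measurable_realfun.
From mathcomp Require Import ring lra.

Set Implicit Arguments.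
Unset Strict Implicit.
Unset Printing Implicit Defensive.

Import Order.TTheory GRing.Theory Num.Theory numFieldNormedType.Exports.

Local Open Scope classical_set_scope.
Local Open Scope ring_scope.

(** * Matrix exponentials *)

(** The feedback reaches factor j only while mode j is active, so the visits to mode j must also pay
    for the growth of that factor in all the other modes. Sojourns may be arbitrarily short, hence
    the overshoot of a fast closed loop is paid at every visit, and its size as a function of the
    gain g is the crux: an overshoot of order exp(g) could cancel the whole benefit. Scaling fixed
    nodes by g makes the eigenvector matrix polynomial in g with a nonzero determinant, which keeps
    the logarithm of the overshoot of order ln g. Per sojourn, mode j has frequency p_j and mean
    occupation p_j tau_j > 0, so the average exponent is - g p_j tau_j + k p_j ln g plus a term free
    of g. A negative mean bounds the Birkhoff sums themselves from above, not only their averages.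
    Each block is therefore O(exp(q t)) at the chosen rational rate q, in exactly the form of the
    events that define the exponent. *)

Section max_norm.
Context {R : realType}.

Lemma mx_entry_le m n (A : 'M[R]_(m, n)) i j : `|A i j| <= `|A|.
Proof.
rewrite [leRHS]/Num.Def.normr /= mx_normrE.
by apply/bigmax_geP; right => /=; exists (i, j).
Qed.

Lemma mx_norm_le m n (A : 'M[R]_(m, n)) c : 0 <= c ->
  (forall i j, `|A i j| <= c) -> `|A| <= c.
Proof.
move=> c0 Ac; rewrite [leLHS]/Num.Def.normr /= mx_normrE.
by apply/bigmax_leP; split => //= -[i j] _; exact: Ac.
Qed.

Lemma mx_norm_mul m n k (A : 'M[R]_(m, n)) (B : 'M[R]_(n, k)) :
  `|A *m B| <= n%:R * (`|A| * `|B|).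
Proof.
apply: mx_norm_le => [|i j]; first by rewrite !mulr_ge0.
rewrite mxE (le_trans (ler_norm_sum _ _ _))//.
rewrite (le_trans (ler_sum _ (G := fun=> `|A| * `|B|) _))//.
  by move=> l _; rewrite normrM ler_pM// mx_entry_le.
by rewrite sumr_const card_ord mulr_natl lexx.
Qed.

End max_norm.

Section expmx.
Context {R : realType}.

Definition expmx_coeff n (L : 'M[R]_n) (i j : 'I_n) : R^nat :=
  fun k => (L ^+ k) i j / k`!%:R.

(** Entrywise power series, so that scalar results on [pseries] give convergence and derivatives. *)
Definition expmx n (L : 'M[R]_n) (t : R) : 'M[R]_n :=
  \matrix_(i, j) limn (pseries (expmx_coeff L i j) t).

(** The factor [n%:R] is the price of the max norm in a product; with it, powers of [growth L]
    dominate the norms of the powers of [L]. *)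
Definition growth n (L : 'M[R]_n) : R := 1 + n%:R * `|L|.

Lemma growth_ge1 n (L : 'M[R]_n) : 1 <= growth L.
Proof. by rewrite lerDl mulr_ge0. Qed.

Lemma expr_mx_le n (L : 'M[R]_n) k : `|L ^+ k| <= growth L ^+ k.
Proof.
elim: k => [|k IH].
  rewrite !expr0; apply: mx_norm_le => // i j.
  by rewrite mxE; case: eqP => _; rewrite ?normr1 ?normr0.
rewrite !exprS (le_trans (mx_norm_mul _ _))// mulrA ler_pM ?mulr_ge0//.
by rewrite lerDr.
Qed.

Lemma expmx_coeff_le n (L : 'M[R]_n) i j t k :
  `|expmx_coeff L i j k * t ^+ k| <= exp_coeff (growth L * `|t|) k.
Proof.
rewrite /exp_coeff/= /expmx_coeff normrM normf_div normrX exprMn.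
rewrite (ger0_norm (_ : 0 <= k`!%:R))// mulrAC ler_wpM2r ?invr_ge0//.
by rewrite ler_wpM2r ?exprn_ge0// (le_trans (mx_entry_le _ _ _))// expr_mx_le.
Qed.

Lemma is_cvg_normed_expmx n (L : 'M[R]_n) i j t :
  cvgn [normed pseries (expmx_coeff L i j) t].
Proof.
apply: (@series_le_cvg _ _ (exp_coeff (growth L * `|t|))) => //= k.
- by rewrite divr_ge0 ?exprn_ge0 ?mulr_ge0 ?(le_trans _ (growth_ge1 L)).
- exact: expmx_coeff_le.
- exact: is_cvg_series_exp_coeff.
Qed.

Lemma is_cvg_expmx n (L : 'M[R]_n) i j t :
  cvgn (pseries (expmx_coeff L i j) t).
Proof. exact/normed_cvg/is_cvg_normed_expmx. Qed.

Lemma cvg_sumr (I : finType) (f : I -> R^nat) (l : I -> R) :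
  (forall i, f i @ \oo --> l i) ->
  (fun N => \sum_i f i N) @ \oo --> \sum_i l i.
Proof.
move=> fl; rewrite (_ : (fun N => _) = \sum_i f i); last first.
  by apply/funext => N; rewrite fct_sumE.
by elim/big_ind2 : _ => // [|x1 x2 y1 y2]; [exact: cvg_cst|exact: cvgD].
Qed.

Lemma cvg_expmx n (L : 'M[R]_n) i j t :
  pseries (expmx_coeff L i j) t @ \oo --> expmx L t i j.
Proof. by rewrite mxE; exact: is_cvg_expmx. Qed.

Lemma expmx_le n (L : 'M[R]_n) t : `|expmx L t| <= expR (growth L * `|t|).
Proof.
apply: mx_norm_le => [|i j]; first exact: expR_ge0.
rewrite mxE (le_trans (lim_series_norm _))//; first exact: is_cvg_normed_expmx.
apply: lim_series_le => [||k].
- exact: is_cvg_normed_expmx.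
- exact: is_cvg_series_exp_coeff.
- exact: expmx_coeff_le.
Qed.

(** The relation passes to powers, then to the partial sums of both series. Taken with a block
    projection for [Q], it makes each factor evolve by itself. *)
Lemma expmx_intertwine m n (Q : 'M[R]_(m, n)) (L : 'M[R]_n) (F : 'M[R]_m) t :
  Q *m L = F *m Q -> Q *m expmx L t = expmx F t *m Q.
Proof.
move=> QL.
have QLk k : Q *m L ^+ k = F ^+ k *m Q.
  elim: k => [|k IH]; first by rewrite !expr0 mulmx1 mul1mx.
  rewrite exprS exprSr -!mulmxE mulmxA.
  by rewrite QL -mulmxA IH mulmxA mulmxE -exprS exprSr.
apply/matrixP => i j; rewrite !mxE.
have /cvg_unique : \sum_(k < n) Q i k * pseries (expmx_coeff L k j) t N
   @[N --> \oo] --> \sum_k Q i k * expmx L t k j.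
  by apply: cvg_sumr => k; apply: cvgMr; exact: cvg_expmx.
apply => //.
have : \sum_(k < m) pseries (expmx_coeff F i k) t N * Q k j
   @[N --> \oo] --> \sum_k expmx F t i k * Q k j.
  by apply: cvg_sumr => k; apply: cvgMl; exact: cvg_expmx.
apply: cvg_trans; apply: near_eq_cvg; near=> N.
transitivity (\sum_(0 <= l < N) (F ^+ l *m Q) i j / l`!%:R * t ^+ l).
  rewrite /pseries/series/=.
  under eq_bigr do rewrite mulr_suml.
  rewrite exchange_big/=; apply: eq_bigr => l _.
  rewrite mxE !mulr_suml; apply: eq_bigr => k _.
  by rewrite /expmx_coeff; ring.
rewrite /pseries/series/=.
under [RHS]eq_bigr do rewrite mulr_sumr.
rewrite [RHS]exchange_big/=; apply: eq_bigr => l _.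
rewrite -QLk mxE !mulr_suml; apply: eq_bigr => k _.
by rewrite /expmx_coeff; ring.
Unshelve. all: by end_near. Qed.

Lemma expmx_comm n (L : 'M[R]_n) t : L *m expmx L t = expmx L t *m L.
Proof. exact: expmx_intertwine. Qed.

Lemma pseries_diffs_expmx n (L : 'M[R]_n) i j :
  pseries_diffs (expmx_coeff L i j) =
  fun k => \sum_l L i l * expmx_coeff L l j k.
Proof.
apply/funext => k; rewrite /pseries_diffs /expmx_coeff exprS factS natrM.
rewrite -mulmxE mxE !mulr_suml mulr_sumr; apply: eq_bigr => l _.
have : k`!%:R != 0 :> R by rewrite pnatr_eq0 -lt0n fact_gt0.
have : k.+1%:R != 0 :> R by rewrite pnatr_eq0.
move: (k`!%:R) k.+1%:R => b a a0 b0.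
by field; rewrite a0 b0.
Qed.

Lemma is_derive_expmx n (L : 'M[R]_n) i j (t : R) :
  is_derive t 1 (fun t => expmx L t i j) ((L *m expmx L t) i j).
Proof.
have cvgL k x : cvgn (fun N => \sum_l L i l * pseries (expmx_coeff L l k) x N).
  apply/cvg_ex; eexists; apply: cvg_sumr => l; apply: cvgMr; exact: cvg_expmx.
have diffsE (c : 'I_n -> R^nat) (a : 'I_n -> R) x :
    pseries (fun k => \sum_l a l * c l k) x =
    fun N => \sum_l a l * pseries (c l) x N.
  apply/funext => N; rewrite /pseries/series/=.
  under [RHS]eq_bigr do rewrite mulr_sumr.
  rewrite [RHS]exchange_big/=; apply: eq_bigr => l _.
  by rewrite mulr_suml; apply: eq_bigr => k _; rewrite mulrA.
have -> : (L *m expmx L t) i j =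
    limn (pseries (pseries_diffs (expmx_coeff L i j)) t).
  apply/esym/cvg_lim => //; rewrite pseries_diffs_expmx diffsE mxE.
  by apply: cvg_sumr => l; apply: cvgMr; exact: cvg_expmx.
under [X in is_derive _ _ X _]eq_fun do rewrite mxE.
(* Termwise differentiation asks for convergence of the series and of its first two formal
   derivatives at one point of larger modulus than [t]. They converge everywhere, so any such point
   serves. *)
apply: (@pseries_snd_diffs _ _ (`|t| + 1)).
- exact: is_cvg_expmx.
- rewrite pseries_diffs_expmx diffsE; exact: cvgL.
- rewrite pseries_diffs_expmx.
  have -> : pseries_diffs (fun k => \sum_l L i l * expmx_coeff L l j k) =
      fun k => \sum_l L i l * pseries_diffs (expmx_coeff L l j) k.
    apply/funext => k; rewrite /pseries_diffs mulr_sumr.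
    by apply: eq_bigr => l _; ring.
  rewrite diffsE; apply/cvg_ex; eexists; apply: cvg_sumr => l; apply: cvgMr.
  rewrite pseries_diffs_expmx diffsE.
  by apply: cvg_sumr => k; apply: cvgMr; exact: cvg_expmx.
- by rewrite [ltRHS]ger0_norm ?ltrDl// addr_ge0.
Qed.

Lemma continuous_expmx n (L : 'M[R]_n) i j :
  continuous (fun t => expmx L t i j).
Proof.
move=> t; apply/differentiable_continuous/derivable1_diffP.
by have [] := is_derive_expmx L i j t.
Qed.

Lemma expmx0 n (L : 'M[R]_n) : expmx L 0 = 1%:M.
Proof.
apply/matrixP => i j; rewrite mxE; apply/cvg_lim => //.
apply: cvg_near_cst; near=> N.
have N0 : (0 < N)%N by near: N; exists 1%N.
rewrite -(prednK N0) /pseries/series/= big_nat_recl//= big1 ?addr0.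
  by rewrite /expmx_coeff expr0 mulr1 divr1 mxE.
by move=> k _; rewrite expr0n mulr0.
Unshelve. all: by end_near. Qed.

(** The product of [expR (- (a * t))] and [Q *m expmx L t] has zero derivative. *)
Lemma expmx_eigen m n (Q : 'M[R]_(m, n)) (L : 'M[R]_n) a t :
  Q *m L = a *: Q -> Q *m expmx L t = expR (a * t) *: Q.
Proof.
move=> QL.
pose h i j (s : R) := expR (- (a * s)) * (Q *m expmx L s) i j.
have dh i j (s : R) : is_derive s 1 (h i j) 0.
  have dQ : is_derive s 1 (fun s => (Q *m expmx L s) i j)
      (\sum_k Q i k * (L *m expmx L s) k j).
    under eq_fun do rewrite mxE.
    have dk k : is_derive s 1 (fun s => Q i k * expmx L s k j)
        (Q i k * (L *m expmx L s) k j).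
      by have d := is_derive_expmx L k j s; apply: is_derive_eq.
    have := is_derive_sum dk.
    by rewrite (_ : \sum_ _ _ = fun s => \sum_k Q i k * expmx L s k j)//;
      apply/funext => u; rewrite fct_sumE.
  have de : is_derive s 1 (fun s => expR (- (a * s))) (- a * expR (- (a * s))).
    by apply: is_derive_eq; rewrite /GRing.scale/= ; ring.
  apply: is_derive_eq; rewrite /GRing.scale/=.
  have -> : \sum_k Q i k * (L *m expmx L s) k j = a * (Q *m expmx L s) i j.
    transitivity ((Q *m (L *m expmx L s)) i j); first by rewrite mxE.
    by rewrite mulmxA QL -scalemxAl mxE.
  ring.
apply/matrixP => i j.
have : h i j t = h i j 0 by apply: is_derive_0_is_cst.
rewrite /h !mulr0 oppr0 expR0 mul1r expmx0 mulmx1 => /(congr1 ( *%R (expR (a * t)))).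
by rewrite mulrA -expRD subrr expR0 mul1r => ->; rewrite mxE.
Qed.

(** As [L] commutes with its exponential, the two terms in the derivative of the product cancel. *)
Lemma expmxN n (L : 'M[R]_n) t : expmx L (- t) *m expmx L t = 1%:M.
Proof.
apply/matrixP => i j.
pose h s := (expmx L (- s) *m expmx L s) i j.
have dh (s : R) : is_derive s 1 h 0.
  have dk k : is_derive s 1 (fun s => expmx L (- s) i k * expmx L s k j)
     (expmx L (- s) i k * (L *m expmx L s) k j -
      (L *m expmx L (- s)) i k * expmx L s k j).
    have d1 := is_derive_expmx L k j s.
    have d2 : is_derive s 1 (fun s => expmx L (- s) i k)
        (- (L *m expmx L (- s)) i k).
      have dn : is_derive (- s) 1 (fun s => expmx L s i k)
          ((L *m expmx L (- s)) i k) by exact: is_derive_expmx.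
      have := @is_derive1_comp _ (fun s => expmx L s i k) (fun s => - s) s _ _ dn _.
      by move=> /(_ (-1)); rewrite mulrN1; apply; exact: is_deriveN.
    by apply: is_derive_eq; rewrite /GRing.scale/=; ring.
  have := is_derive_sum dk.
  rewrite (_ : \sum_ _ _ = h); last first.
    by apply/funext => u; rewrite fct_sumE /h mxE.
  move=> H; apply: (is_derive_eq H).
  rewrite sumrB.
  transitivity ((expmx L (- s) *m (L *m expmx L s)
    - L *m expmx L (- s) *m expmx L s) i j); first by rewrite !mxE.
  by rewrite (expmx_comm L (- s)) -mulmxA subrr mxE.
have : h t = h 0 by apply: is_derive_0_is_cst.
by rewrite /h oppr0 !expmx0 mulmx1.
Qed.

End expmx.

(** * Pole shifting *)

Section polynomial_bounds.
Context {R : realType}.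

Lemma poly_le_expr (p : {poly R}) x : 1 <= x ->
  `|p.[x]| <= (\sum_(i < size p) `|p`_i|) * x ^+ size p.
Proof.
move=> x1; rewrite horner_coef (le_trans (ler_norm_sum _ _ _))// mulr_suml.
apply: ler_sum => i _; rewrite normrM ler_wpM2l// normrX ger0_norm ?(le_trans _ x1)//.
by rewrite ler_weXn2l// ltnW.
Qed.

Lemma mx_poly_le_expr m n (P : 'M[{poly R}]_(m, n)) :
  exists C k, 0 <= C /\
    forall x, 1 <= x -> `|map_mx (horner^~ x) P| <= C * x ^+ k.
Proof.
exists (\sum_i \sum_j \sum_(l < size (P i j)) `|(P i j)`_l|),
  (\sum_i \sum_j size (P i j))%N; split.
  by do 3![apply: sumr_ge0 => ? _].
move=> x x1; have x0 : 0 <= x by apply: le_trans x1.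
apply: mx_norm_le => [|i j].
  by rewrite mulr_ge0 ?exprn_ge0//; do 3![apply: sumr_ge0 => ? _].
rewrite mxE (le_trans (poly_le_expr _ x1))// ler_pM ?sumr_ge0 ?exprn_ge0//.
  rewrite (bigD1 i)//= (bigD1 j)//= -addrA lerDl addr_ge0//.
    by do 2![apply: sumr_ge0 => ? _].
  by do 3![apply: sumr_ge0 => ? _].
by rewrite ler_weXn2l// (bigD1 i)//= (bigD1 j)//= -addnA leq_addr.
Qed.

(** The polynomial [q] is monic, hence positive beyond its Cauchy bound. The factor ['X] ensures
    that subtracting 1 leaves the leading term alone even when [p] is constant. *)
Lemma poly_ge_inv (p : {poly R}) : p != 0 ->
  exists c b, [/\ 0 < c, 1 <= b & forall x, b <= x -> c / x <= `|p.[x]|].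
Proof.
move=> p0; have lc0 : lead_coef p != 0 by rewrite lead_coef_eq0.
pose q := 'X * ((lead_coef p)^-1 *: p) - 1.
have qm : q \is monic.
  have s : (size ((- 1)%R : {poly R}) < size ('X * ((lead_coef p)^-1 *: p))%R)%N.
    rewrite size_polyN size_poly1 mulrC size_mulX ?scaler_eq0 ?invr_eq0 ?negb_or ?lc0//.
    by rewrite size_scale ?invr_eq0// ltnS lt0n size_poly_eq0.
  by rewrite monicE lead_coefDl// lead_coefM lead_coefX mul1r lead_coefZ mulVf.
have [b qb] := monic_Cauchy_bound qm.
exists `|lead_coef p|, (Num.max b 1); split.
- by rewrite normr_gt0.
- by rewrite le_max lexx orbT.
move=> x; rewrite ge_max => /andP[bx x1].
have x0 : 0 < x by apply: lt_le_trans x1.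
have := qb x bx; rewrite /q !hornerE/= subr_gt0 => h.
rewrite ler_pdivrMr// mulrC.
rewrite -(ler_pM2l (_ : 0 < `|lead_coef p|^-1)) ?invr_gt0 ?normr_gt0//.
rewrite mulVf ?normr_eq0// mulrCA -normfV -normrM -{1}(ger0_norm (ltW x0)) -normrM.
by apply: le_trans (ler_norm _); rewrite mulrA ltW.
Qed.

End polynomial_bounds.

Section pole_shifting.
Context {R : realType} {n m : nat}.
Implicit Types (A : 'M[R]_n) (B : 'M[R]_(n, m)).

(* Kalman's criterion: no nonzero row space is A-invariant and orthogonal to
   the range of B. *)
Definition kalman A B := forall Q : 'M[R]_n,
  (Q *m A <= Q)%MS -> Q *m B = 0 -> Q = 0.

(** For invertible A + s I this is (A + s I)^-1 B times the determinant; unlike the inverse it is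
    polynomial in [s] and makes sense at every [s]. *)
Definition adj_shift A B (s : R) : 'M[R]_(n, m) := \adj (A + s%:M) *m B.

Lemma poly_eq0_nat (p : {poly R}) k :
  (size p <= k)%N -> (forall i : 'I_k, p.[i.+1%:R] = 0) -> p = 0.
Proof.
move=> pk p0; apply: (@roots_geq_poly_eq0 _ p [seq i.+1%:R | i <- iota 0 k]).
- apply/allP => x /mapP[i]; rewrite mem_iota/= add0n => ik ->.
  by rewrite rootE (p0 (Ordinal ik)).
- rewrite map_inj_uniq ?iota_uniq// => i j /eqP.
  by rewrite eqr_nat => /eqP[].
- by rewrite size_map size_iota.
Qed.

Lemma map_horner_char A s :
  map_mx (horner_eval s) (char_poly_mx (- A)) = A + s%:M.
Proof.
rewrite /char_poly_mx map_mxB map_scalar_mx/= horner_evalE hornerX.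
rewrite addrC; congr (_ + _); apply/matrixP => i j.
by rewrite !mxE horner_evalE hornerC opprK.
Qed.

Lemma map_horner_polyC p q (D : 'M[R]_(p, q)) x :
  map_mx (horner_eval x) (map_mx polyC D) = D.
Proof. by apply/matrixP => a b; rewrite !mxE horner_evalE hornerC. Qed.

(* If l kills \adj (A + s I) B for enough s, then l \adj (A + 'X I) B = 0 as a
   polynomial, and the coefficients of l \adj (A + 'X I) span an A-invariant row
   space orthogonal to B. *)
Lemma adj_shift_span A B : kalman A B ->
  exists k, forall l : 'rV[R]_n,
    (forall s : 'I_k, l *m adj_shift A B s.+1%:R = 0) -> l = 0.
Proof.
move=> AB; pose AX := char_poly_mx (- A).
(* [k] bounds the size of every entry of [lp], so zeros at 1, ..., k force the entries of
   [lp *m map_mx polyC B] to vanish. *)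
pose k := (\sum_i \sum_j size (\adj AX i j))%N.
exists k => l l0.
pose lp := map_mx polyC l *m \adj AX.
have lps i : (size (lp 0%R i) <= k)%N.
  rewrite mxE (leq_trans (size_sum _ _ _))//; apply/bigmax_leqP => j _.
  rewrite mxE mul_polyC (leq_trans (size_scale_leq _ _))// /k.
  by rewrite (bigD1 j)//= (bigD1 i)//= -addnA leq_addr.
have lpB : lp *m map_mx polyC B = 0.
  apply/matrixP => i j; rewrite ord1 [RHS]mxE; apply: (@poly_eq0_nat _ k).
    rewrite mxE (leq_trans (size_sum _ _ _))//; apply/bigmax_leqP => q _.
    by rewrite [in X in _ * X]mxE mulrC mul_polyC (leq_trans (size_scale_leq _ _)).
  move=> s; have := l0 s => /matrixP/(_ 0 j); rewrite [RHS]mxE => <-.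
  transitivity (map_mx (horner_eval s.+1%:R) (lp *m map_mx polyC B) 0 j).
    by rewrite [RHS]mxE.
  rewrite !map_mxM/= !map_horner_polyC map_mx_adj map_horner_char.
  by rewrite /adj_shift mulmxA.
have lpA : lp *m AX = char_poly (- A) *: map_mx polyC l.
  by rewrite -mulmxA mul_adj_mx mul_mx_scalar.
clearbody lp.
pose c q : 'rV[R]_n := \row_j (lp 0 j)`_q.
have cB q : c q *m B = 0.
  apply/matrixP => i j; rewrite ord1 [LHS]mxE [RHS]mxE.
  have : (lp *m map_mx polyC B) 0 j = \sum_r lp 0 r * (B r j)%:P.
    by rewrite [LHS]mxE; apply: eq_bigr => r _; rewrite [map_mx _ _ _ _]mxE.
  rewrite lpB [LHS]mxE => /(congr1 (fun p : {poly R} => p`_q)).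
  rewrite coef0 coef_sum => H.
  transitivity (\sum_r (lp 0 r * (B r j)%:P)`_q); last exact/esym.
  apply: eq_bigr => r _.
  by rewrite coefMC [c q _ _]mxE.
(* Comparison of the coefficients of degree [q] in [lpA], where [AX] is 'X I + A. *)
have cA q : (char_poly (- A))`_q *: l = (if q is q'.+1 then c q' else 0) + c q *m A.
  move/matrixP: lpA => lpA; apply/matrixP => i j; rewrite ord1.
  have /(congr1 (fun p : {poly R} => p`_q)) := lpA 0 j.
  have -> : (char_poly (- A) *: map_mx polyC l) 0 j = char_poly (- A) * (l 0 j)%:P.
    by rewrite [LHS]mxE [map_mx _ _ _ _]mxE.
  rewrite coefMC => lpAj; rewrite [LHS]mxE -lpAj.
  have -> : (lp *m AX) 0 j = lp 0 j * 'X + \sum_r lp 0 r * (A r j)%:P.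
    rewrite /AX /char_poly_mx mulmxBr mul_mx_scalar [LHS]mxE.
    congr (_ + _); first by rewrite mxE mulrC.
    rewrite mxE [in LHS]mxE -sumrN; apply: eq_bigr => r _.
    by rewrite [map_mx _ _ _ _]mxE [(- A) _ _]mxE polyCN mulrN opprK.
  rewrite coefD coefMX coef_sum [RHS]mxE.
  congr (_ + _); first by case: (q) => [|q']; rewrite mxE.
  by rewrite [RHS]mxE; apply: eq_bigr => r _; rewrite [c q _ _]mxE coefMC.
(* Above degree n the left side of [cA] is zero, so a vanishing coefficient makes the preceding one
   vanish; the descent starts at [k]. *)
have c0 q : (n <= q)%N -> c q = 0.
  have cbig r : (k <= r)%N -> c r = 0.
    by move=> kr; apply/matrixP => i j; rewrite !mxE nth_default// (leq_trans (lps _)).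
  have step r : (n < r)%N -> c r = 0 -> c r.-1 = 0.
    case: r => // r nr cr; have := cA r.+1.
    by rewrite cr mul0mx addr0/= nth_default ?scale0r// size_char_poly.
  move=> nq; suff : forall j, (j <= k)%N -> c (q + (k - j))%N = 0.
    by move/(_ k (leqnn _)); rewrite subnn addn0.
  elim=> [_|j IH jk]; first by rewrite subn0 cbig// leq_addl.
  have e : (q + (k - j.+1) = (q + (k - j)).-1)%N by rewrite -(subnSK jk) addnS.
  by rewrite e; apply: step; [rewrite -(subnSK jk) addnS ltnS (leq_trans nq)// leq_addr|exact/IH/ltnW].
(* At degree n the characteristic polynomial has coefficient 1, so [l] is itself a coefficient of
   [lp]. This closes the span [Q] under [A] and puts [l] inside it. *)
have lE : l = if n is n'.+1 then c n' else 0.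
  have := cA n; rewrite (c0 n)// mul0mx addr0 => <-.
  have /monicP := char_poly_monic (- A).
  by rewrite /lead_coef size_char_poly => ->; rewrite scale1r.
pose Q := \matrix_(q < n) c q.
have cQ (q : nat) : (c q <= Q)%MS.
  case: (ltnP q n) => [qn|/c0->]; last exact: sub0mx.
  by have := row_sub (Ordinal qn) Q; rewrite rowK.
have prevQ (q : nat) : ((if q is q'.+1 then c q' else 0) <= Q)%MS.
  by case: q => [|q']; rewrite ?sub0mx ?cQ.
have lQ : (l <= Q)%MS by rewrite lE prevQ.
have Q0 : Q = 0.
  apply: AB; last first.
    by apply/row_matrixP => q; rewrite row_mul rowK cB row0.
  apply/row_subP => q; rewrite row_mul rowK.
  have -> : c q *m A = (char_poly (- A))`_q *: l - (if q : nat is q'.+1 then c q' else 0).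
    by rewrite (cA q) addrAC subrr add0r.
  by rewrite addmx_sub ?scalemx_sub// eqmx_opp prevQ.
by apply/eqP; rewrite -submx0 -Q0.
Qed.

(** Stacked for all nodes, the columns of [adj_shift] have no common left annihilator, so they span
    and n of them form a basis. Several may share the same node. *)
Lemma adj_shift_columns A B : kalman A B ->
  exists (s : 'I_n -> nat) (g : 'I_n -> 'I_m),
    \matrix_(i, j) adj_shift A B (s j).+1%:R i (g j) \in unitmx.
Proof.
move=> /adj_shift_span[k kP].
pose T : finType := ('I_k * 'I_m)%type; pose W : 'M[R]_(#|T|, n) :=
  \matrix_(q < #|T|, i < n)
    adj_shift A B (val (enum_val q).1).+1%:R i ((enum_val q).2).
have Wfull : row_full W.
  rewrite /row_full -mxrank_tr -[_ == _]/(row_free W^T) -kermx_eq0.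
  apply/eqP/row_matrixP => r; rewrite row0; apply: kP => s.
  have /(congr1 (row r)) : kermx W^T *m W^T = 0 by exact: mulmx_ker.
  rewrite row_mul row0 => /matrixP K0; apply/matrixP => i j; rewrite ord1.
  have := K0 0 (enum_rank (s, j)); rewrite [LHS]mxE [RHS]mxE => K0j.
  rewrite [LHS]mxE [RHS]mxE; apply: etrans K0j.
  by apply: eq_bigr => q _; rewrite [W^T _ _]mxE [W _ _]mxE enum_rankK.
exists (fun j => val (enum_val (fullrankfun Wfull j)).1),
  (fun j => (enum_val (fullrankfun Wfull j)).2).
have := fullrowsub_unit Wfull; rewrite -unitmx_tr; congr (_ \in unitmx).
by apply/matrixP => i j; rewrite !mxE.
Qed.

(* The columns of Y become eigenvectors: A + s I maps the column
   \adj (A + s I) b to \det (A + s I) b, which the feedback cancels. *)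
Lemma feedback_eigen A B (s : 'I_n -> R) (g : 'I_n -> 'I_m) :
  let Y := \matrix_(i, j) adj_shift A B (s j) i (g j) in
  Y \in unitmx ->
  exists K : 'M[R]_(m, n), (A + B *m K) *m Y = Y *m diag_mx (\row_j - s j).
Proof.
move=> Y Yu.
pose V := \matrix_(i < m, j < n) (\det (A + (s j)%:M) *+ (i == g j)).
exists (- (V *m invmx Y)).
rewrite mulmxDl mulmxN mulNmx -!mulmxA mulVmx// mulmx1.
apply/matrixP => i j; rewrite mul_mx_diag !mxE.
transitivity ((A *m adj_shift A B (s j)) i (g j)
    - \det (A + (s j)%:M) * B i (g j)).
  congr (_ - _); first by rewrite mxE; apply: eq_bigr => l _; rewrite mxE.
  rewrite (bigD1 (g j))//= !mxE eqxx mulr1n mulrC big1 ?addr0// => l lg.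
  by rewrite mxE (negPf lg) mulr0n mulr0.
have -> : A = (A + (s j)%:M) - (s j)%:M by rewrite addrK.
rewrite {1}/adj_shift mulmxBl mulmxA subrK mul_mx_adj !mul_scalar_mx !mxE.
by rewrite addrAC subrr sub0r mulrN mulrC.
Qed.

(* K puts the eigenvalues at - (s_j + 1) g for naturals s_j independent of g, so
   the eigenvector matrix is polynomial in g and its condition number grows at
   most like a power of g. *)
Lemma pole_shifting A B : kalman A B ->
  exists C k g0, [/\ 0 < C, 1 <= g0 & forall g, g0 <= g ->
    exists K : 'M[R]_(m, n), forall t, 0 <= t ->
      `|expmx (A + B *m K) t| <= C * g ^+ k * expR (- (g * t))].
Proof.
move=> /adj_shift_columns[s [g Yu]].
pose YX : 'M[{poly R}]_n := \matrix_(i, j)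
  (\adj (map_mx polyC A + ((s j).+1%:R *: 'X)%:M) *m map_mx polyC B) i (g j).
pose Y x := \matrix_(i, j) adj_shift A B ((s j).+1%:R * x) i (g j).
have YE x : Y x = map_mx (horner_eval x) YX.
  apply/matrixP => i j; rewrite [LHS]mxE [RHS]mxE [YX i j]mxE.
  set Z := (_ *m map_mx polyC B).
  transitivity (map_mx (horner_eval x) Z i (g j)); last by rewrite [LHS]mxE.
  rewrite map_mxM/= map_mx_adj map_mxD map_scalar_mx !map_horner_polyC/=.
  by rewrite horner_evalE !hornerE.
have detY x : \det (Y x) = (\det YX).[x] by rewrite YE det_map_mx.
(* At x = 1 the matrix is the basis of [adj_shift_columns], so the determinant is a nonzero
   polynomial in x. *)
have D0 : \det YX != 0.
  apply/eqP => D0; have := detY 1; rewrite D0 horner0 => /eqP.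
  apply/negP; rewrite -unitfE -unitmxE /Y.
  by under eq_mx do rewrite mulr1.
have [c [b [c0 b1 cP]]] := poly_ge_inv D0.
have [C1 [k1 [C10 C1P]]] := mx_poly_le_expr YX.
have [C2 [k2 [C20 C2P]]] := mx_poly_le_expr (\adj YX).
(* Product of the bounds on [Y x] and on its inverse, the adjugate over a determinant of modulus at
   least c / x, which accounts for the additional power of x. The final 1 makes the constant
   positive. *)
exists (n%:R * (C1 * (C2 / c)) + 1), (k1 + (k2 + 1))%N, b; split => //.
  by rewrite ltr_wpDl// !mulr_ge0// invr_ge0 ltW.
move=> x bx; have x1 : 1 <= x by apply: le_trans bx.
have x0 : 0 < x by apply: lt_le_trans x1.
have Dx := cP x bx.
have Dx0 : 0 < `|(\det YX).[x]| by apply: lt_le_trans Dx; rewrite divr_gt0.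
have Yux : Y x \in unitmx by rewrite unitmxE unitfE detY -normr_gt0.
have [K KP] := feedback_eigen Yux.
exists K => t t0.
have YinvA : invmx (Y x) *m (A + B *m K) =
    diag_mx (\row_j - ((s j).+1%:R * x)) *m invmx (Y x).
  by rewrite -[LHS]mulmx1 -(mulmxV Yux) -mulmxA [X in _ *m X]mulmxA KP !mulmxA mulVmx ?mul1mx.
(* The rows of the inverse are left eigenvectors, with eigenvalues at most - x because each node is
   at least 1. *)
have normE : `|invmx (Y x) *m expmx (A + B *m K) t| <=
    expR (- (x * t)) * `|invmx (Y x)|.
  apply: mx_norm_le => [|i j]; first by rewrite mulr_ge0 ?expR_ge0.
  have rowE : row i (invmx (Y x)) *m (A + B *m K) =
      - ((s i).+1%:R * x) *: row i (invmx (Y x)).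
    by rewrite -row_mul YinvA mul_diag_mx; apply/rowP => l; rewrite !mxE.
  have /matrixP/(_ 0 j) := expmx_eigen t rowE.
  rewrite -row_mul [LHS]mxE => ->; rewrite !mxE.
  rewrite normrM ger0_norm ?expR_ge0// ler_pM ?expR_ge0 ?mx_entry_le//.
  rewrite ler_expR mulNr lerN2 ler_wpM2r// ler_peMl ?(ltW x0)//.
  by rewrite ler1n.
have normY : `|Y x| <= C1 * x ^+ k1 by rewrite YE; exact: C1P.
have normYV : `|invmx (Y x)| <= C2 / c * x ^+ (k2 + 1).
  rewrite /invmx Yux normrZ normfV detY YE -map_mx_adj.
  rewrite [leRHS](_ : _ = x / c * (C2 * x ^+ k2)); last first.
    by rewrite exprD expr1; ring.
  rewrite ler_pM ?invr_ge0//; last exact: C2P.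
  by rewrite -[leRHS]invf_div lef_pV2 ?posrE ?divr_gt0.
have -> : expmx (A + B *m K) t = Y x *m (invmx (Y x) *m expmx (A + B *m K) t).
  by rewrite mulmxA mulmxV ?mul1mx.
apply: (le_trans (mx_norm_mul _ _)).
apply: (@le_trans _ _ (n%:R * (C1 * x ^+ k1 * (expR (- (x * t)) * (C2 / c * x ^+ (k2 + 1)))))).
  rewrite ler_wpM2l// ler_pM// (le_trans normE)// ler_wpM2l// expR_ge0//.
rewrite [leLHS](_ : _ = n%:R * (C1 * (C2 / c)) * x ^+ (k1 + (k2 + 1)) * expR (- (x * t))); last first.
  by rewrite (exprD x k1); move: (x ^+ (k2 + 1)) (expR _) (C2 / c) => *; ring.
rewrite ler_wpM2r ?expR_ge0// ler_wpM2r ?exprn_ge0 ?(ltW x0)//.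
by rewrite lerDl.
Qed.

End pole_shifting.

(** * Integral form of linear equations *)

Section integral_unions_sums.
Context d (T : measurableType d) (R : realType) (mu : {measure set T -> \bar R}).

Lemma integrable_setU (A B : set T) (f : T -> R) : measurable A -> measurable B ->
  mu.-integrable A (EFin \o f) -> mu.-integrable B (EFin \o f) ->
  mu.-integrable (A `|` B) (EFin \o f).
Proof.
move=> mA mB fA fB; have mBA : measurable (B `\` A) by exact: measurableD.
have fBA : mu.-integrable (B `\` A) (EFin \o f).
  by apply: integrableS fB => //; exact: subDsetl.
apply/integrable_mkcond; first exact: measurableU.
have fA' := iffLR (integrable_mkcond _ mA) fA.
have fBA' := iffLR (integrable_mkcond _ mBA) fBA.
apply: eq_integrable (integrableD _ fA' fBA') => // x _.
rewrite !patchE; case: (boolP (x \in A)) => xA.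
  rewrite in_setU xA/= ifF ?adde0//.
  by apply/negbTE; rewrite notin_setE => -[_]; apply; exact/set_mem.
rewrite in_setU (negPf xA)/= add0e; congr (if _ then _ else _).
by rewrite in_setD xA andbT.
Qed.

Lemma Rintegral_sum n (D : set T) (f : 'I_n -> T -> R) : measurable D ->
  (forall i, mu.-integrable D (EFin \o f i)) ->
  mu.-integrable D (EFin \o (fun s => \sum_i f i s)) /\
  \int[mu]_(s in D) (\sum_i f i s) = \sum_i \int[mu]_(s in D) f i s.
Proof.
move=> mD fi.
have e : EFin \o (fun s => \sum_i f i s) = fun s => (\sum_i (f i s)%:E)%E.
  by apply/funext => s /=; rewrite sumEFin.
split; first by rewrite e; apply: integrable_sum => // i _; exact: fi.
rewrite /Rintegral (_ : (fun s => _) = fun s => (\sum_i (f i s)%:E)%E)//.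
rewrite integral_sum//.
rewrite -sum_fine// => i _.
by apply: integrable_fin_num => //; exact: fi.
Qed.

End integral_unions_sums.

Section integration.
Context {R : realType}.
Notation leb := (@lebesgue_measure R).

Lemma Rintegral_FTC (F f : R -> R) (a b : R) : a <= b -> continuous f ->
  (forall x : R, is_derive x 1 F (f x)) ->
  leb.-integrable `[a, b] (EFin \o f) /\ \int[leb]_(x in `[a, b]) f x = F b - F a.
Proof.
move=> ab cf dF; split.
  apply: continuous_compact_integrable; first exact: segment_compact.
  exact: continuous_subspaceT.
move: ab; rewrite le_eqVlt => /predU1P[->|ab].
  by rewrite set_itv1 Rintegral_set1 subrr.
have cF : continuous F.
  move=> x; apply/differentiable_continuous/derivable1_diffP.
  by have [] := dF x.
rewrite /Rintegral (@continuous_FTC2 _ f F)//.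
- exact: continuous_subspaceT.
- split => [x _||]; first by have [] := dF x.
  + exact/cvg_at_right_filter/cF.
  + exact/cvg_at_left_filter/cF.
- by move=> x _; rewrite derive1E; have [] := dF x.
Qed.

Lemma le_pow2 (f c : R) : 0 <= c -> (forall k, f <= c / 2 ^+ k) -> f <= 0.
Proof.
move=> c0 fc; rewrite leNgt; apply/negP => f0.
have := fc (Num.bound (c / f)); rewrite ler_pdivlMr ?exprn_gt0//.
rewrite leNgt => /negP; apply.
rewrite mulrC -ltr_pdivrMr//.
have := archi_boundP (divr_ge0 c0 (ltW f0)) => h; apply: (lt_trans h).
by rewrite -natrX ltr_nat ltn_expl.
Qed.

(** The bound M 2^-k exp(2 b t) reproduces itself with one more factor 1/2, since the integral of
    exp(2 b s) up to t is at most exp(2 b t) / (2 b). *)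
Lemma gronwall0 (f : R -> R) (b T M : R) : 0 < b ->
  (forall t, 0 <= t <= T -> 0 <= f t <= M) ->
  leb.-integrable `[0, T] (EFin \o f) ->
  (forall t, 0 <= t <= T -> f t <= b * \int[leb]_(s in `[0, t]) f s) ->
  forall t, 0 <= t <= T -> f t = 0.
Proof.
move=> b0 fM fi fb.
have step k t : 0 <= t <= T -> f t <= M / 2 ^+ k * expR (2 * b * t).
  elim: k t => [|k IH] t /[dup] tT /andP[t0 tT'].
    have /andP[f0 ftM] := fM t tT.
    rewrite expr0 divr1 (le_trans ftM)// ler_peMr ?(le_trans f0)//.
    by rewrite -expR0 ler_expR !mulr_ge0// ltW.
  have M0 : 0 <= M by have /andP[f0 ftM] := fM t tT; rewrite (le_trans f0).
  rewrite (le_trans (fb t tT))//.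
  have dF (x : R) : is_derive x 1 (fun s => M / 2 ^+ k / (2 * b) * expR (2 * b * s))
     (M / 2 ^+ k * expR (2 * b * x)).
    by apply: is_derive_eq; rewrite /GRing.scale/=; field; rewrite gt_eqF ?exprn_gt0//= gt_eqF.
  have cf : continuous (fun x : R => M / 2 ^+ k * expR (2 * b * x)).
    move=> x; apply: cvgMr; apply: continuous_comp; last exact: continuous_expR.
    by apply: cvgMr; exact: cvg_id.
  have [gi gI] := Rintegral_FTC t0 cf dF.
  have fti : leb.-integrable `[0, t] (EFin \o f).
    apply: integrableS fi => //; apply: subset_itvl.
    by rewrite bnd_simp.
  have /le_trans-> // : b * \int[leb]_(s in `[0, t]) f s <=
      b * \int[leb]_(s in `[0, t]) (M / 2 ^+ k * expR (2 * b * s)).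
    rewrite ler_wpM2l ?(ltW b0)// le_Rintegral// => s/=.
    rewrite in_itv/= => /andP[s0 st]; apply: IH.
    by rewrite s0 (le_trans st).
  rewrite gI mulr0 expR0 mulr1 exprSr.
  rewrite [leRHS](_ : _ = b * (M / 2 ^+ k / (2 * b) * expR (2 * b * t))); last first.
    by field; rewrite gt_eqF ?exprn_gt0//= gt_eqF.
  rewrite ler_wpM2l ?(ltW b0)// lerBlDr lerDl.
  by rewrite !divr_ge0// ?exprn_ge0 ?mulr_ge0 ?(ltW b0).
move=> t tT; have /andP[f0 ftM] := fM t tT.
have M0 : 0 <= M by rewrite (le_trans f0).
apply/eqP; rewrite eq_le f0 andbT.
apply: (@le_pow2 _ (M * expR (2 * b * t))); first by rewrite mulr_ge0 ?expR_ge0.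
by move=> k; rewrite mulrAC; exact: step.
Qed.

End integration.

Section primitives.
Context {R : realType}.
Notation leb := (@lebesgue_measure R).

Lemma primitive_on_mul n m (Q : 'M[R]_(m, n)) T (v x : R -> 'cV[R]_n) :
  primitive_on T v x ->
  primitive_on T (fun s => Q *m v s) (fun s => Q *m x s).
Proof.
move=> vx i.
have Qv k t : 0 <= t <= T -> leb.-integrable `[0, t] (EFin \o (fun s => Q i k * v s k 0)).
  move=> /andP[t0 tT]; have [vi _] := vx k.
  have : leb.-integrable `[0, T] (EFin \o (fun s => Q i k * v s k 0)).
    exact: (@integrableZl _ _ _ leb `[0, T] (measurable_itv _) (Q i k) _ vi).
  apply: integrableS => //; apply: subset_itvl.
  by rewrite bnd_simp.
have e : (fun s => (Q *m v s) i 0) = fun s => \sum_k Q i k * v s k 0.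
  by apply/funext => s; rewrite mxE.
split.
  have [T0|T0] := leP 0 T; last by rewrite set_itv_ge ?bnd_simp ?leNgt ?T0//; exact: integrable_set0.
  have TT : 0 <= T <= T by rewrite T0 lexx.
  have [+ _] := @Rintegral_sum _ _ _ leb n `[0, T] _ (measurable_itv _) (fun k => Qv k _ TT).
  by rewrite -e.
move=> t tT; rewrite e.
have [_ ->] := @Rintegral_sum _ _ _ leb n `[0, t] _ (measurable_itv _) (fun k => Qv k _ tT).
rewrite !mxE -big_split/=; apply: eq_bigr => k _.
have [vi ->//] := vx k; rewrite mulrDr RintegralZl//.
apply: integrableS vi => //; apply: subset_itvl.
by move/andP : tT => [_ ?]; rewrite bnd_simp.
Qed.

Lemma primitive_on_sub n T (v v' x x' : R -> 'cV[R]_n) :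
  primitive_on T v x -> primitive_on T v' x' ->
  primitive_on T (fun s => v s - v' s) (fun s => x s - x' s).
Proof.
move=> vx vx' i; have [vi xi] := vx i; have [vi' xi'] := vx' i; split.
  have := @integrableB _ _ _ leb `[0, T] (measurable_itv _) _ _ vi vi'.
  apply: eq_integrable => // s _ /=.
  by rewrite !mxE EFinB.
move=> t /[dup] tT /andP[_ tT']; rewrite !mxE xi// xi'//.
have -> : \int[leb]_(s in `[0, t]) (v s - v' s) i 0 =
    \int[leb]_(s in `[0, t]) (v s i 0 - v' s i 0).
  by apply: eq_Rintegral => s _; rewrite !mxE.
have sub : [set` `[0, t]] `<=` [set` `[0, T]].
  by apply: subset_itvl; rewrite bnd_simp.
rewrite RintegralB//; [by ring|exact: integrableS vi|exact: integrableS vi'].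
Qed.

Lemma eq_primitive_on n T (v v' x x' : R -> 'cV[R]_n) :
  v =1 v' -> x =1 x' -> primitive_on T v x -> primitive_on T v' x'.
Proof. by move=> /funext -> /funext ->. Qed.

(** Gronwall's argument for the sum of the moduli of the coordinates; [L] is only bounded in time,
    which covers a switched matrix. *)
Lemma primitive_on_unique n (L : R -> 'M[R]_n) beta T (y : R -> 'cV[R]_n) :
  0 < T -> (forall s, `|L s| <= beta) -> y 0 = 0 ->
  primitive_on T (fun s => L s *m y s) y ->
  forall t, 0 <= t <= T -> y t = 0.
Proof.
move=> T0 Lb y0 yL t tT.
have beta0 : 0 <= beta by apply: le_trans (Lb 0).
pose f (s : R) := \sum_k `|y s k 0|.
have yE i s : 0 <= s <= T ->
    y s i 0 = \int[leb]_(u in `[0, s]) (L u *m y u) i 0.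
  by move=> sT; have [_ ->//] := yL i; rewrite y0 mxE add0r.
have vint i s : 0 <= s <= T -> leb.-integrable `[0, s] (EFin \o (fun u => (L u *m y u) i 0)).
  move=> /andP[s0 sT]; have [vi _] := yL i.
  by apply: integrableS vi => //; apply: subset_itvl; rewrite bnd_simp.
(* As an indefinite integral [y] is continuous on the segment, hence integrable there. *)
have yi i : leb.-integrable `[0, T] (EFin \o (fun s => y s i 0)).
  have := @parameterized_integral_continuous _ 0 T _ (ltW T0) (proj1 (yL i)).
  move=> /(continuous_compact_integrable (@segment_compact _ _ _)).
  apply: eq_integrable => // s; rewrite inE/= in_itv/= => sT.
  by rewrite /= yE.
have TT : 0 <= T <= T by rewrite (ltW T0) lexx.
have ynorm i : leb.-integrable `[0, T] (EFin \o (fun s => `|y s i 0|)).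
  exact: (integrable_norm (yi i)).
have fint s : 0 <= s <= T -> leb.-integrable `[0, s] (EFin \o f).
  move=> /andP[s0 sT].
  have [fi _] := @Rintegral_sum _ _ _ leb n `[0, T] _ (measurable_itv _) ynorm.
  by apply: integrableS fi => //; apply: subset_itvl; rewrite bnd_simp.
have vf i u : `|(L u *m y u) i 0| <= beta * f u.
  rewrite mxE (le_trans (ler_norm_sum _ _ _))// mulr_sumr ler_sum// => k _.
  by rewrite normrM ler_wpM2r// (le_trans (mx_entry_le _ _ _)).
have yb i s : 0 <= s <= T -> `|y s i 0| <= beta * \int[leb]_(u in `[0, s]) f u.
  move=> sT; rewrite yE// (le_trans (le_normr_Rintegral _ (vint i s sT)))//.
  rewrite -RintegralZl//; last exact: fint.
  apply: le_Rintegral => //.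
  - exact: (integrable_norm (vint i s sT)).
  - exact: (@integrableZl _ _ _ leb `[0, s] (measurable_itv _) beta _ (fint s sT)).
have fb s : 0 <= s <= T -> f s <= (n%:R * beta + 1) * \int[leb]_(u in `[0, s]) f u.
  move=> sT; have I0 : 0 <= \int[leb]_(u in `[0, s]) f u.
    by apply: Rintegral_ge0 => u _; exact: sumr_ge0.
  apply: (@le_trans _ _ (n%:R * beta * \int[leb]_(u in `[0, s]) f u)); last first.
    by rewrite ler_wpM2r// lerDl.
  rewrite -mulrA mulr_natl -[X in _ *+ X](card_ord n) -sumr_const ler_sum// => i _.
  exact: yb.
have f0 : f t = 0.
  (* The [+ 1] keeps the rate positive. The uniform bound comes from [fb] itself, the integral of
     the nonnegative [f] being largest at [T]. *)
  apply: (@gronwall0 _ f (n%:R * beta + 1) T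
    ((n%:R * beta + 1) * \int[leb]_(u in `[0, T]) f u)) => //.
  - by rewrite ltr_wpDl// mulr_ge0.
  - move=> s sT; rewrite sumr_ge0//= (le_trans (fb s sT))//.
    rewrite ler_wpM2l ?addr_ge0 ?mulr_ge0//.
    have /andP[s0 sT'] := sT.
    rewrite -subr_ge0 Rintegral_itvB ?bnd_simp//; last exact: fint.
    by apply: Rintegral_ge0 => u _; exact: sumr_ge0.
  - exact: fint.
apply/matrixP => i j; rewrite ord1 [RHS]mxE; apply/eqP; rewrite -normr_eq0.
move/eqP: f0; rewrite psumr_eq0// => /allP/(_ i); apply.
by rewrite mem_index_enum.
Qed.

(* Along a trajectory from 0, Q x solves an autonomous linear equation, hence
   vanishes, although it can end anywhere in the range of Q. *)
Lemma controllable_kalman n m (A : 'M[R]_n) (B : 'M[R]_(n, m)) :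
  controllable A B -> kalman A B.
Proof.
move=> AB Q /submxP[F QA] QB.
have Qx (x1 : 'cV[R]_n) : Q *m x1 = 0.
  have [T [u [x [T0 _ xAB x0 <-]]]] := AB 0 x1.
  apply: (@primitive_on_unique _ (fun=> F) `|F| T (fun s => Q *m x s)) => //.
  - by rewrite x0 mulmx0.
  - apply: eq_primitive_on (primitive_on_mul Q xAB) => // s.
    by rewrite mulmxDr !mulmxA QA QB mul0mx addr0.
  - by rewrite (ltW T0) lexx.
apply/matrixP => i j; have /matrixP/(_ i 0) := Qx (delta_mx j 0).
by rewrite -colE !mxE.
Qed.

(** Extends the integral form across one sojourn, on which [x] is a classical primitive. The
    velocity is prescribed on a half-open interval because the mode changes at [b]; that point is a
    null set. *)
Lemma primitive_glue (v x G g : R -> R) (a b : R) : 0 <= a -> a <= b ->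
  leb.-integrable `[0, a] (EFin \o v) ->
  (forall t, 0 <= t <= a -> x t = x 0 + \int[leb]_(s in `[0, t]) v s) ->
  continuous g -> (forall s : R, is_derive s 1 G (g s)) ->
  (forall s, a <= s < b -> v s = g s) -> (forall t, a <= t <= b -> x t = G t) ->
  leb.-integrable `[0, b] (EFin \o v) /\
  (forall t, 0 <= t <= b -> x t = x 0 + \int[leb]_(s in `[0, t]) v s).
Proof.
move=> a0 ab va xa cg dG vg xG.
have [gi _] := Rintegral_FTC ab cg dG.
have vb : leb.-integrable `[a, b[ (EFin \o v).
  apply: (@eq_integrable _ _ _ leb `[a, b[ _ (EFin \o g)) => //.
    by move=> s; rewrite inE/= in_itv/= => sab; rewrite vg.
  by apply: integrableS gi => //; apply: subset_itvl; rewrite bnd_simp.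
have vi : leb.-integrable `[0, b] (EFin \o v).
  have -> : `[0, b]%classic = (`[0, a] `|` `[a, b[) `|` [set b] :> set R.
    apply/seteqP; split => s /=; rewrite !in_itv/=.
      move=> /andP[s0]; rewrite le_eqVlt => /predU1P[->|sb]; first by right.
      by left; rewrite s0 sb andbT/=; apply/orP; exact: le_total.
    move=> [[/andP[s0 sa]|/andP[as_ sb]]|->].
    - by rewrite s0 (le_trans sa).
    - by rewrite (le_trans a0 as_) ltW.
    - by rewrite (le_trans a0 ab) lexx.
  apply: integrable_setU => //; first exact: measurableU.
    exact: integrable_setU.
  apply: null_set_integrable => //; last exact: lebesgue_measure_set1.
  exact: measurable_fun_set1.
split => // t /andP[t0 tb].
have [ta|ta] := leP t a; first by rewrite xa// t0.
have vt : leb.-integrable `[0, t] (EFin \o v).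
  by apply: integrableS vi => //; apply: subset_itvl; rewrite bnd_simp.
have := @Rintegral_itvB _ v (BLeft 0) (BRight t) a vt; rewrite !bnd_simp => /(_ a0 (ltW ta)).
have vat : leb.-integrable `]a, t[ (EFin \o v).
  by apply: integrableS vt => //; apply: subset_itv; rewrite bnd_simp.
rewrite -(Rintegral_itv_bndo_bndc vat).
have cgt := Rintegral_FTC (ltW ta) cg dG.
have gat : leb.-integrable `]a, t] (EFin \o g).
  by apply: integrableS (proj1 cgt) => //; apply: subset_itvr; rewrite bnd_simp.
have gat' : leb.-integrable `]a, t[ (EFin \o g).
  by apply: integrableS gat => //; apply: subset_itvl; rewrite bnd_simp.
have -> : \int[leb]_(s in `]a, t[) v s = \int[leb]_(s in `]a, t[) g s.
  apply: eq_Rintegral => s; rewrite inE/= in_itv/= => /andP[as_ st].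
  by rewrite vg// ltW//= (lt_le_trans st).
rewrite (Rintegral_itv_bndo_bndc gat') (Rintegral_itv_obnd_cbnd gat) (proj2 cgt).
move/eqP; rewrite subr_eq => /eqP ->.
rewrite [in RHS]addrC -addrA -(addrC (x 0)) -xa ?a0 ?lexx//.
rewrite !xG ?lexx ?ab//; last by rewrite tb ltW.
by rewrite subrK.
Qed.

End primitives.

(** * Solutions and exponential growth along a switching path *)

Section switched_solutions.
Context {R : realType} {N d : nat}.
Notation leb := (@lebesgue_measure R).
Implicit Types (L : 'I_N.+1 -> 'M[R]_d) (w : switching_path R N).

(* Unlike [Omega0], zero durations are excluded; this is still an almost sure
   event and makes the switching times strictly increasing. *)
Definition regular w :=
  (forall k, 0 < (w k).2) /\ switch_time w n @[n --> \oo] --> +oo.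

(** Fundamental matrix of the switched equation at time [switch_time w n]. *)
Fixpoint transition L w n : 'M[R]_d :=
  if n is n'.+1 then expmx (L (w n').1) (w n').2 *m transition L w n'
  else 1%:M.

Lemma switch_time0 w : switch_time w 0 = 0.
Proof. by rewrite /switch_time big_ord0. Qed.

Lemma switch_timeS w n : switch_time w n.+1 = switch_time w n + (w n).2.
Proof. by rewrite /switch_time big_ord_recr. Qed.

Lemma regular_Omega0 w : regular w -> Omega0 w.
Proof. by move=> [w0 ws]; split => // k; exact: ltW. Qed.

Lemma switch_time_le w m n : regular w -> (m <= n)%N ->
  switch_time w m <= switch_time w n.
Proof.
move=> [w0 _] /subnKC <-; elim: (n - m)%N => [|k IH]; first by rewrite addn0.
by rewrite addnS switch_timeS (le_trans IH)// lerDl ltW.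
Qed.

Lemma switch_time_ge0 w n : regular w -> 0 <= switch_time w n.
Proof. by move=> rw; rewrite -(switch_time0 w) switch_time_le. Qed.

Lemma switch_time_locate w t : regular w -> 0 <= t ->
  exists n, switch_time w n <= t < switch_time w n.+1.
Proof.
move=> rw t0; have [_ /cvgryPgt/(_ t)[m _ mP]] := rw.
have ex : exists m, t < switch_time w m by exists m; exact: mP (leqnn m).
case: (ex_minnP ex) => -[|n] tn nmin; first by rewrite switch_time0 ltNge t0 in tn.
by exists n; rewrite tn andbT leNgt; apply/negP => /nmin; rewrite ltnn.
Qed.

Lemma switch_time_unique w t m n : regular w ->
  switch_time w m <= t < switch_time w m.+1 ->
  switch_time w n <= t < switch_time w n.+1 -> m = n.
Proof.
move=> rw /andP[mt tm] /andP[nt tn]; apply/eqP; rewrite eqn_leq; apply/andP; split.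
  rewrite leqNgt; apply/negP => nm.
  by have := lt_le_trans (le_lt_trans mt tn) (switch_time_le rw nm); rewrite ltxx.
rewrite leqNgt; apply/negP => nm.
by have := lt_le_trans (le_lt_trans nt tm) (switch_time_le rw nm); rewrite ltxx.
Qed.

Lemma alphaE w t n : regular w ->
  switch_time w n <= t < switch_time w n.+1 -> alpha w t = (w n).1.
Proof.
move=> rw tn; apply: xget_unique; first by exists n.
by move=> _ [m [tm ->]]; rewrite (switch_time_unique rw tn tm).
Qed.

Lemma is_derive_expmx_mul m (A : 'M[R]_d) (c : 'M[R]_(d, m)) (a t : R) i j :
  is_derive t 1 (fun s : R => (expmx A (s - a) *m c) i j)
    ((A *m expmx A (t - a) *m c) i j).
Proof.
have dk k : is_derive t 1 (fun s : R => expmx A (s - a) i k * c k j)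
    ((A *m expmx A (t - a)) i k * c k j).
  have d1 : is_derive t 1 (fun s : R => expmx A (s - a) i k)
      ((A *m expmx A (t - a)) i k).
    have dn := is_derive_expmx A i k (t - a).
    have ds : is_derive t 1 (fun s : R => s - a) 1.
      by apply: is_derive_eq; rewrite subr0.
    have := @is_derive1_comp _ (fun s => expmx A s i k) (fun s => s - a) t _ _ dn ds.
    by rewrite mulr1.
  by apply: is_derive_eq; rewrite /GRing.scale/=; ring.
have := is_derive_sum dk.
rewrite (_ : \sum_ _ _ = fun s => (expmx A (s - a) *m c) i j); last first.
  by apply/funext => s; rewrite fct_sumE mxE.
by move=> H; apply: (is_derive_eq H); rewrite [RHS]mxE.
Qed.

(** The candidate follows an exponential inside each sojourn, and [primitive_glue] extends its
    integral form one sojourn at a time. Both endpoints of a sojourn are allowed, since consecutive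
    formulas agree there. *)
Lemma exists_solution L w (x0 : 'cV[R]_d) : regular w ->
  exists2 x, is_solution L w x0 x &
    forall n r, 0 <= r <= (w n).2 ->
      x (switch_time w n + r) = expmx (L (w n).1) r *m (transition L w n *m x0).
Proof.
move=> rw; have [w0 _] := rw.
pose idx t := xget 0%N [set n | switch_time w n <= t < switch_time w n.+1].
pose x t := expmx (L (w (idx t)).1) (t - switch_time w (idx t)) *m
  (transition L w (idx t) *m x0).
have idxE t n : switch_time w n <= t < switch_time w n.+1 -> idx t = n.
  move=> tn; apply: xget_unique => // m tm.
  exact: switch_time_unique rw tm tn.
have xE n r : 0 <= r <= (w n).2 ->
    x (switch_time w n + r) = expmx (L (w n).1) r *m (transition L w n *m x0).
  move=> /andP[r0]; rewrite le_eqVlt => /predU1P[->|rn].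
    rewrite -switch_timeS /x (idxE _ n.+1); last first.
      by rewrite lexx/= [ltRHS]switch_timeS ltrDl w0.
    by rewrite subrr expmx0 mul1mx/= mulmxA.
  rewrite /x (idxE _ n); last by rewrite switch_timeS lerDl r0 ltrD2l.
  by rewrite addrAC subrr add0r.
exists x => //; split.
  have := xE 0%N 0; rewrite switch_time0 addr0 => ->.
    by rewrite expmx0/= !mul1mx.
  by rewrite lexx ltW.
have H n i : leb.-integrable `[0, switch_time w n]
      (EFin \o (fun s => (L (alpha w s) *m x s) i 0)) /\
    forall t, 0 <= t <= switch_time w n -> x t i 0 = x 0 i 0 +
      \int[leb]_(s in `[0, t]) (L (alpha w s) *m x s) i 0.
  elim: n => [|n [IH1 IH2]].
    rewrite switch_time0 set_itv1; split.
      apply: null_set_integrable => //; last exact: lebesgue_measure_set1.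
      exact: measurable_fun_set1.
    by move=> t; rewrite -eq_le => /eqP <-; rewrite set_itv1 Rintegral_set1 addr0.
  set a := switch_time w n in IH1 IH2 *; set A := L (w n).1.
  set c := transition L w n *m x0.
  have ab : a <= switch_time w n.+1 by exact: switch_time_le.
  apply: (@primitive_glue _ _ _ (fun t => (expmx A (t - a) *m c) i 0)
    (fun t => (A *m expmx A (t - a) *m c) i 0) a) => //.
  - exact: switch_time_ge0.
  - move=> t; apply/differentiable_continuous/derivable1_diffP.
    rewrite (_ : (fun t => _) = fun t => (expmx A (t - a) *m (A *m c)) i 0).
      by have [] := is_derive_expmx_mul A (A *m c) a t i 0.
    by apply/funext => s; rewrite expmx_comm mulmxA.
  - move=> s; exact: is_derive_expmx_mul.
  - move=> s sab; rewrite (alphaE rw sab) -mulmxA; congr ((_ *m _) _ _).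
    by rewrite /x (idxE _ _ sab).
  - move=> t /andP[at_ tb]; rewrite -{1}(subrK a t) addrC xE//.
    by rewrite subr_ge0 at_ lerBlDl -switch_timeS.
move=> T T0 i; have [n /andP[_ Tn]] := switch_time_locate rw (ltW T0).
have [Hi Hx] := H n.+1 i; split.
  by apply: integrableS Hi => //; apply: subset_itvl; rewrite bnd_simp ltW.
by move=> t /andP[t0 tT]; rewrite Hx// t0 (le_trans tT)// ltW.
Qed.

Lemma is_solution_unique L w (x0 : 'cV[R]_d) x y t : 0 <= t ->
  is_solution L w x0 x -> is_solution L w x0 y -> x t = y t.
Proof.
move=> t0 [x00 xL] [y00 yL]; apply/eqP; rewrite -subr_eq0; apply/eqP.
have t1 : 0 < t + 1 by rewrite ltr_wpDl.
apply: (@primitive_on_unique _ d (fun s => L (alpha w s)) (\sum_i `|L i|) (t + 1)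
  (fun s => x s - y s)) => //.
- by move=> s; rewrite (bigD1 (alpha w s))//= lerDl sumr_ge0.
- by rewrite x00 y00 subrr.
- apply: eq_primitive_on (primitive_on_sub (xL _ t1) (yL _ t1)) => // s.
  by rewrite mulmxBr.
- by rewrite t0 lerDl ler01.
Qed.

(** [xget] picks an unspecified solution; uniqueness at nonnegative times identifies it with the
    explicit one. *)
Lemma phi_rcE L w (x0 : 'cV[R]_d) n r : regular w -> 0 <= r <= (w n).2 ->
  phi_rc L w x0 (switch_time w n + r) =
  expmx (L (w n).1) r *m transition L w n *m x0.
Proof.
move=> rw rn; have [x xL xE] := exists_solution L x0 rw.
rewrite -mulmxA -xE//; apply: (@is_solution_unique L w x0) => //.
  by rewrite addr_ge0 ?switch_time_ge0//; case/andP: rn.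
by apply: (@xgetPex _ (fun=> 0) [set x | is_solution L w x0 x]); exists x.
Qed.

End switched_solutions.

Section bounded_growth.
Context {R : realType} {N d : nat}.
Implicit Types (L : 'I_N.+1 -> 'M[R]_d) (w : switching_path R N).

(* Sampling each sojourn at rational fractions of its length, and bounding by a
   natural number, makes this a countable combination of measurable events. *)
Definition bounded_growth L c w := exists C : nat, forall n m k, (k <= m)%N ->
  `|expmx (L (w n).1) (k%:R / m.+1%:R * (w n).2) *m transition L w n| <=
  C%:R * expR (c * (switch_time w n + k%:R / m.+1%:R * (w n).2)).

Definition shift_path w : switching_path R N := fun k => w k.+1.

Lemma switch_time_shift w n :
  switch_time w n.+1 = (w 0%N).2 + switch_time (shift_path w) n.
Proof. by rewrite /switch_time big_ord_recl. Qed.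

Lemma transition_shift L w n : transition L w n.+1 =
  transition L (shift_path w) n *m expmx (L (w 0%N).1) (w 0%N).2.
Proof.
elim: n => [|n IH]; first by rewrite /= mulmx1 mul1mx.
by rewrite [in LHS]/= -/(transition L w n.+1) IH mulmxA.
Qed.

Lemma bounded_growth_real L c w (C : R) :
  (forall n m k, (k <= m)%N ->
    `|expmx (L (w n).1) (k%:R / m.+1%:R * (w n).2) *m transition L w n| <=
    C * expR (c * (switch_time w n + k%:R / m.+1%:R * (w n).2))) ->
  bounded_growth L c w.
Proof.
move=> CP; exists (Num.bound `|C|) => n m k km.
rewrite (le_trans (CP n m k km))// ler_wpM2r ?expR_ge0//.
by rewrite (le_trans (ler_norm _))// ltW// archi_boundP.
Qed.

Lemma frac_itv m k : (k <= m)%N -> 0 <= (k%:R / m.+1%:R : R) <= 1.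
Proof.
by move=> km; rewrite divr_ge0//= ler_pdivrMr// mul1r ler_nat leqW.
Qed.

(** Dropping the first sojourn removes an invertible right factor and translates time by a fixed
    amount; both are absorbed by the constant. *)
Lemma bounded_growth_shift L c w :
  bounded_growth L c (shift_path w) <-> bounded_growth L c w.
Proof.
set E := expmx (L (w 0%N).1) (w 0%N).2.
split=> [[C CP]|[C CP]].
  (* The first summand serves the sojourns after the first one, the second serves the first sojourn
     itself. *)
  apply: (@bounded_growth_real _ _ _
    (d%:R * C%:R * `|E| * expR (`|c| * `|(w 0%N).2|) +
     d%:R * expR ((growth (L (w 0%N).1) + `|c|) * `|(w 0%N).2|) * `|1%:M : 'M[R]_d|)).
  move=> [|n] m k km.
    rewrite switch_time0 add0r mulrDl ler_wpDl ?mulr_ge0 ?expR_ge0//.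
    rewrite (le_trans (mx_norm_mul _ _))//.
    rewrite [leRHS](_ : _ = d%:R * (expR ((growth (L (w 0%N).1) + `|c|) * `|(w 0%N).2|) * expR (c * (k%:R / m.+1%:R * (w 0%N).2)) * `|1%:M : 'M[R]_d|)); last by ring.
    rewrite ler_wpM2l// ler_wpM2r//.
    rewrite (le_trans (expmx_le _ _))// -expRD ler_expR.
    have /andP[u0 u1] := frac_itv km.
    set u := k%:R / m.+1%:R in u0 u1 *.
    rewrite normrM (ger0_norm u0).
    have h1 : growth (L (w 0%N).1) * (u * `|(w 0%N).2|) <= growth (L (w 0%N).1) * `|(w 0%N).2|.
      by rewrite ler_wpM2l ?(le_trans _ (growth_ge1 _))// ler_piMl.
    have /ler_normlP[h2 _] : `|c * (u * (w 0%N).2)| <= `|c| * `|(w 0%N).2|.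
      by rewrite normrM ler_wpM2l// normrM (ger0_norm u0) ler_piMl.
    by move: (growth _) h1 => g h1; lra.
  rewrite transition_shift mulmxA (le_trans (mx_norm_mul _ _))//.
  have XC := CP n m k km.
  rewrite switch_time_shift -(addrA (w 0%N).2) (mulrDr c) (expRD (c * _)).
  change (w n.+1) with (shift_path w n).
  move: XC; set X := `|_ *m _|; set e := expR (c * (_ + _)) => XC.
  apply: (@le_trans _ _ (d%:R * (C%:R * e * `|E|))).
    by rewrite ler_wpM2l// ler_wpM2r.
  rewrite mulrDl ler_wpDr ?mulr_ge0 ?expR_ge0//.
  rewrite [leRHS](_ : _ = d%:R * (C%:R * e * `|E|) *
    (expR (`|c| * `|(w 0%N).2|) * expR (c * (w 0%N).2))); last by ring.
  rewrite ler_peMr ?mulr_ge0 ?expR_ge0// -expRD -expR0 ler_expR -normrM.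
  by rewrite -lerBlDr sub0r -normrN ler_norm.
(* In the converse direction the first factor is cancelled by the exponential at the opposite
   time. *)
apply: (@bounded_growth_real _ _ _
  (d%:R * (C%:R * expR (c * (w 0%N).2) * `|expmx (L (w 0%N).1) (- (w 0%N).2)|))) => n m k km.
have := CP n.+1 m k km.
rewrite switch_time_shift -(addrA (w 0%N).2) (mulrDr c) (expRD (c * _)).
change (w n.+1) with (shift_path w n); set e := expR (c * (_ + _)).
set X := _ *m _ => XC.
have -> : expmx (L (shift_path w n).1) (k%:R / m.+1%:R * (shift_path w n).2) *m
   transition L (shift_path w) n = X *m expmx (L (w 0%N).1) (- (w 0%N).2).
  rewrite /X transition_shift -!mulmxA; congr (_ *m _).
  rewrite -{1}[(w 0%N).2]opprK expmxN mulmx1//.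
rewrite (le_trans (mx_norm_mul _ _))//.
set Y := `|expmx (L (w 0%N).1) _|; rewrite [leRHS](_ : _ = d%:R * (C%:R * (expR (c * (w 0%N).2) * e) * Y)); last by ring.
rewrite ler_wpM2l// ler_wpM2r//; exact: normr_ge0.
Qed.

(** The sampled fractions are dense in the sojourn and both sides are continuous in [r]. *)
Lemma bounded_growth_sojourn L c w : regular w -> bounded_growth L c w ->
  exists2 C : R, 0 < C & forall n r, 0 <= r <= (w n).2 ->
    `|expmx (L (w n).1) r *m transition L w n| <=
    C * expR (c * (switch_time w n + r)).
Proof.
move=> [w0 _] [C CP]; exists (C%:R + 1); first by rewrite ltr_wpDl.
move=> n r /andP[r0 rn]; apply: mx_norm_le => [|i j].
  by rewrite mulr_ge0 ?expR_ge0// addr_ge0.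
pose u := r / (w n).2.
have u0 : 0 <= u by rewrite divr_ge0// ltW.
have u1 : u <= 1 by rewrite ler_pdivrMr// mul1r.
(* The numerator is at most m, as the sampling requires, and the quotient tends to [u] even for
   [u = 1], a fraction that is never sampled. *)
pose v m : R := (Num.truncn (m%:R * u))%:R / m.+1%:R.
have vu : v m @[m --> \oo] --> u.
  apply/cvgrPdist_le => e e0; near=> m.
  have /truncn_itv/andP[t1 t2] : 0 <= m%:R * u by rewrite mulr_ge0.
  have h : `|u - v m| <= 2 / m.+1%:R.
    rewrite -[u in `|u - _|](mulfK (_ : m.+1%:R != 0))// -mulrBl normrM.
    rewrite normfV (ger0_norm (_ : 0 <= m.+1%:R))// ler_wpM2r ?invr_ge0//.
    rewrite -natr1 in t2; rewrite -natr1 ler_norml; nra.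
  rewrite (le_trans h)// ler_pdivrMr// mulrC -ler_pdivrMr//.
  have : 2 / e <= m%:R by near: m; exact: nbhs_infty_ger.
  by move=> /le_trans; apply; rewrite ler_nat.
pose f s := (expmx (L (w n).1) s *m transition L w n) i j.
have cf : continuous f.
  move=> s; apply/differentiable_continuous/derivable1_diffP.
  have [] := is_derive_expmx_mul (L (w n).1) (transition L w n) 0 s i j.
  by under eq_fun do rewrite subr0.
have vr : v m * (w n).2 @[m --> \oo] --> r.
  have -> : r = u * (w n).2 by rewrite divfK// gt_eqF.
  exact: cvgMl.
have fr : `|f (v m * (w n).2)| @[m --> \oo] --> `|f r|.
  by apply: cvg_norm; apply: continuous_cvg => //; exact: cf.
have er : C%:R * expR (c * (switch_time w n + v m * (w n).2)) @[m --> \oo] -->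
    C%:R * expR (c * (switch_time w n + r)).
  apply: cvgMr; apply: continuous_cvg; first exact: continuous_expR.
  by apply: cvgMr; apply: cvgD => //; exact: cvg_cst.
have H : `|f r| <= C%:R * expR (c * (switch_time w n + r)).
  apply: ler_cvg_to fr er _; near=> m.
  have km : (Num.truncn (m%:R * u) <= m)%N.
    rewrite -(ler_nat R) (@le_trans _ _ (m%:R * u))// ?ler_piMr//.
    by rewrite truncn_le mulr_ge0.
  exact: le_trans (mx_entry_le _ _ _) (CP n m _ km).
by rewrite (le_trans H)// ler_wpM2r ?expR_ge0// lerDl.
Unshelve. all: by end_near. Qed.

Lemma expmx_unit n (A : 'M[R]_n) t : expmx A t \in unitmx.
Proof. by have /mulmx1_unit[] := expmxN A t. Qed.

Lemma transition_unit L w n : transition L w n \in unitmx.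
Proof. by elim: n => [|n IH] /=; rewrite ?unitmx1// unitmx_mul expmx_unit. Qed.

Lemma phi_rc_neq0 L w x0 t : regular w -> x0 != 0 -> 0 <= t ->
  0 < `|phi_rc L w x0 t|.
Proof.
move=> rw x00 t0; have [n /andP[nt tn]] := switch_time_locate rw t0.
rewrite -(subrK (switch_time w n) t) addrC phi_rcE//; last first.
  by rewrite subr_ge0 nt/= lerBlDl -switch_timeS ltW.
rewrite normr_gt0; apply: contra x00 => /eqP e.
have U : expmx (L (w n).1) (t - switch_time w n) *m transition L w n \in unitmx.
  by rewrite unitmx_mul expmx_unit transition_unit.
by rewrite -(mulKmx U x0) e mulmx0.
Qed.

Lemma lambda_rc_le L w c x0 : regular w -> x0 != 0 -> bounded_growth L c w ->
  (lambda_rc L w x0 <= c%:E)%E.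
Proof.
move=> rw x00 /(bounded_growth_sojourn rw)[C C0 CP].
have phib t : 0 <= t -> `|phi_rc L w x0 t| <= d%:R * C * `|x0| * expR (c * t).
  move=> t0; have [n /andP[nt tn]] := switch_time_locate rw t0.
  have tE : t = switch_time w n + (t - switch_time w n) by rewrite addrC subrK.
  have rn : 0 <= t - switch_time w n <= (w n).2.
    by rewrite subr_ge0 nt/= lerBlDl -switch_timeS ltW.
  rewrite {1}tE phi_rcE// (le_trans (mx_norm_mul _ _))//.
  rewrite -!mulrA ler_wpM2l// [leRHS](_ : _ = C * expR (c * t) * `|x0|); last by ring.
  by rewrite ler_wpM2r// {2}tE CP.
set K := d%:R * C * `|x0| in phib.
apply/lee_addgt0Pr => e e0; apply: ge_ereal_inf.
set f := fun t : R => _.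
(* Beyond this time the contribution ln K / t of the constant is at most [e]. *)
exists (ereal_sup (f @` [set t | `|ln K| / e < t])).
  by exists [set t | `|ln K| / e < t] => //; exists (`|ln K| / e); rewrite num_real.
apply: ge_ereal_sup => _ [t /= Kt <-]; rewrite lee_fin.
have t0 : 0 < t by apply: le_lt_trans Kt; rewrite divr_ge0// ltW.
have phi0 := phi_rc_neq0 L rw x00 (ltW t0).
have K0 : 0 < K.
  by have := lt_le_trans phi0 (phib t (ltW t0)); rewrite pmulr_lgt0 ?expR_gt0.
rewrite mulrC ler_pdivrMr// (@le_trans _ _ (ln (K * expR (c * t))))//.
  have KE : 0 < K * expR (c * t) by rewrite mulr_gt0// expR_gt0.
  by rewrite ler_ln ?posrE//; exact/phib/ltW.
rewrite lnM ?posrE ?expR_gt0// expRK mulrDl addrC lerD2l.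
by rewrite mulrC -ler_pdivrMr// ltW// (le_lt_trans _ Kt)// ler_wpM2r ?invr_ge0 ?(ltW e0)// ler_norm.
Qed.

(** The columns of the fundamental matrix are the solutions from the basis vectors. The strict
    inequality puts them below exp(c t) from some time on, and only finitely many sojourns start
    before it. *)
Lemma bounded_growth_lambda_rc L (c : R) w : regular w ->
  (forall j, (lambda_rc L w (delta_mx j 0%R) < c%:E)%E) -> bounded_growth L c w.
Proof.
move=> rw lc.
have colE A j : A *m (delta_mx j 0 : 'cV[R]_d) = col j A by rewrite colE.
have delta0 j : delta_mx j 0 != 0 :> 'cV[R]_d.
  apply/eqP => /matrixP/(_ j 0); rewrite !mxE !eqxx => /eqP.
  by rewrite oner_eq0.
have /choice[T TP] j : exists T, forall t, T < t -> 0 < t ->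
    `|phi_rc L w (delta_mx j 0) t| <= expR (c * t).
  have /ereal_inf_lt[_ [V [T [_ TV]] <-] Vc] := lc j.
  exists T => t Tt t0; have phi0 := phi_rc_neq0 L rw (delta0 j) (ltW t0).
  have : ((t^-1 * ln `|phi_rc L w (delta_mx j 0) t|)%:E <= c%:E)%E.
    by apply: le_trans (ltW Vc); apply: ereal_sup_ubound; exists t => //; exact: TV.
  rewrite lee_fin mulrC ler_pdivrMr// => h.
  by rewrite -[leLHS]lnK ?posrE// ler_expR.
pose T' := \sum_j `|T j|.
have T'0 : 0 <= T' by apply: sumr_ge0.
have [n0 /andP[_ Tn0]] := switch_time_locate rw T'0.
(* Crude bound on sojourn [n]; its last factor makes up for exp(c t) being small when [c] is
   negative. *)
pose D n := d%:R * (expR (growth (L (w n).1) * (w n).2) * `|transition L w n|) *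
  expR (`|c| * switch_time w n.+1).
have D0 n : 0 <= D n by rewrite !mulr_ge0 ?expR_ge0.
have [w0 _] := rw.
apply: (@bounded_growth_real _ _ _ (\sum_(n < n0.+1) D n + 1)) => n m k km.
have /andP[u0 u1] := frac_itv km.
set u := k%:R / m.+1%:R in u0 u1 *.
have r0 : 0 <= u * (w n).2 by rewrite mulr_ge0// ltW.
have rn : u * (w n).2 <= (w n).2 by rewrite ler_piMl// ltW.
set r := u * (w n).2 in r0 rn *.
have [nn0|nn0] := leqP n n0.
  apply: (@le_trans _ _ (D n * expR (c * (switch_time w n + r)))); last first.
    rewrite ler_wpM2r ?expR_ge0// (bigD1 (Ordinal (nn0 : n < n0.+1)%N))//= -addrA lerDl.
    by rewrite addr_ge0// sumr_ge0.
  rewrite (le_trans (mx_norm_mul _ _))// /D -!mulrA ler_wpM2l//.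
  rewrite [leRHS](_ : _ = expR (growth (L (w n).1) * (w n).2) *
     (expR (`|c| * switch_time w n.+1) * expR (c * (switch_time w n + r))) *
     `|transition L w n|); last by ring.
  rewrite ler_wpM2r// (le_trans (expmx_le _ _))//.
  apply: (@le_trans _ _ (expR (growth (L (w n).1) * (w n).2))).
    by rewrite ler_expR ger0_norm// ler_wpM2l// (le_trans _ (growth_ge1 _)).
  rewrite ler_peMr ?expR_ge0// -expRD -expR0 ler_expR.
  have sr0 : 0 <= switch_time w n + r by rewrite addr_ge0// switch_time_ge0.
  rewrite (@le_trans _ _ (`|c| * (switch_time w n + r) + c * (switch_time w n + r)))//.
    by rewrite -mulrDl mulr_ge0// -lerBlDr sub0r -normrN ler_norm.
  by rewrite lerD2r ler_wpM2l// switch_timeS lerD2l.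
apply: mx_norm_le => [|i j].
  by rewrite mulr_ge0 ?expR_ge0// addr_ge0// sumr_ge0.
have sn : T' < switch_time w n + r.
  by rewrite (lt_le_trans Tn0)// (le_trans (switch_time_le rw nn0))// lerDl.
have Tj : T j < switch_time w n + r.
  rewrite (le_lt_trans _ sn)// /T' (bigD1 j)//= (le_trans (ler_norm _))//.
  by rewrite lerDl sumr_ge0.
have := TP j _ Tj (le_lt_trans T'0 sn).
rewrite phi_rcE ?r0// colE => h.
apply: (@le_trans _ _ (expR (c * (switch_time w n + r)))).
  apply: le_trans h; have := mx_entry_le (col j (expmx (L (w n).1) r *m transition L w n)) i 0.
  by rewrite [col _ _ _ _]mxE.
by rewrite ler_peMl ?expR_ge0// lerDr sumr_ge0.
Qed.

End bounded_growth.

(** * The law of the switching path *)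

Section path_space.
Context {R : realType} {N : nat}.
Notation Om := (Omega R N).
Implicit Types (i : nat -> 'I_N.+1) (U : nat -> set R).

Definition first_sojourn (j : 'I_N.+1) (V : set R) : set Om :=
  [set w | (w 0%N).1 = j /\ V (w 0%N).2].

Lemma cylinder0 i U : cylinder 0 i U = [set: switching_path R N].
Proof. by apply/seteqP; split => // w _ k. Qed.

Lemma cylinderS n i U : cylinder n.+1 i U =
  first_sojourn (i 0%N) (U 0%N) `&`
  @shift_path R N @^-1` cylinder n (fun k => i k.+1) (fun k => U k.+1).
Proof.
apply/seteqP; split => [w wn|w [w0 wn] [|k] kn]; last exact: wn.
- by split => [|k kn]; exact: wn.
- exact: w0.
Qed.

Lemma measurable_cylinder n i U : (forall k, measurable (U k)) ->
  measurable (cylinder n i U : set Om).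
Proof. by move=> mU; apply: sub_sigma_algebra; exists n, i, U. Qed.

Lemma setI_closed_cylinders : setI_closed (@cylinders R N).
Proof.
move=> _ _ [n [i [U [mU ->]]]] [n' [i' [U' [mU' ->]]]].
(* Positions beyond a cylinder's length are unconstrained; where the two prescribed modes disagree,
   the duration set is emptied. *)
pose V k := (if (k < n)%N then U k else setT) `&`
  (if (k < n')%N then if (k < n)%N && (i k != i' k) then set0 else U' k else setT).
exists (maxn n n'), (fun k => if (k < n)%N then i k else i' k), V; split.
  move=> k; rewrite /V; apply: measurableI; first by case: ifP.
  by case: ifP => // _; case: ifP.
apply/seteqP; split => [w [wn wn'] k|w wV].
  rewrite leq_max => kn; rewrite /V.
  have [kn0|kn0] := ltnP k n; have [kn'|kn'] := ltnP k n' => /=.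
  - have [h1 h2] := wn k kn0; have [h1' h2'] := wn' k kn'.
    by rewrite -h1 -h1' eqxx.
  - by have [h1 h2] := wn k kn0.
  - by have [h1 h2] := wn' k kn'.
  - by move: kn; rewrite !ltnNge kn0 kn'.
split => k kn.
  have := wV k; rewrite leq_max kn /V => /(_ erefl)[h1 [h2 _]].
  by rewrite kn in h2.
have := wV k; rewrite leq_max kn orbT /V kn => /(_ erefl)[+ [_]].
case: ltnP => [_ ->|_ -> //].
by case: eqVneq => [->|].
Qed.

Lemma first_sojournE j V : first_sojourn j V = cylinder 1 (fun=> j) (fun=> V).
Proof. by rewrite cylinderS cylinder0 preimage_setT setIT. Qed.

Lemma measurable_first_sojourn j V : measurable V -> measurable (first_sojourn j V).
Proof. by move=> mV; rewrite first_sojournE; exact: measurable_cylinder. Qed.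

Lemma bigcup_ord (T : Type) (F : 'I_N.+1 -> set T) :
  \bigcup_j F j = \big[setU/set0]_j F j.
Proof.
rewrite -bigcup_seq; apply: eq_bigcupl.
by split => j //= _; exact: mem_index_enum.
Qed.

Lemma measurable_shift : measurable_fun [set: Om] (@shift_path R N : Om -> Om).
Proof.
apply: (@measurability _ _ Om Om _ _ (@cylinders R N)) => //.
move=> _ [_ [n [i [U [mU ->]]]] <-]; rewrite setTI.
have -> : @shift_path R N @^-1` cylinder n i U = \bigcup_(j : 'I_N.+1)
    cylinder n.+1 (fun k => if k is k'.+1 then i k' else j)
      (fun k => if k is k'.+1 then U k' else setT).
  apply/seteqP; split => [w wn|w [j _]]; last by rewrite cylinderS => -[].
  by exists (w 0%N).1 => //; rewrite cylinderS.
rewrite bigcup_ord; apply: bigsetU_measurable => j _.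
by apply: measurable_cylinder => -[|k].
Qed.

Lemma measurable_preimage_shift (A : set Om) : measurable A ->
  measurable (@shift_path R N @^-1` A : set Om).
Proof.
by move=> mA; rewrite -[X in measurable X]setTI; exact: measurable_shift.
Qed.

Lemma measurable_sojourn k j V : measurable V ->
  measurable [set w : Om | (w k).1 = j /\ V (w k).2].
Proof.
move=> mV; elim: k => [|k IH]; first exact: measurable_first_sojourn.
exact: measurable_preimage_shift IH.
Qed.

Lemma measurable_mode k j : measurable [set w : Om | (w k).1 = j].
Proof.
have := measurable_sojourn k j measurableT.
by congr measurable; apply/seteqP; split => w //= -[].
Qed.

Lemma measurable_duration k : measurable_fun [set: Om] (fun w : Om => (w k).2).
Proof.
move=> _ V mV; rewrite setTI.
have -> : (fun w : Om => (w k).2) @^-1` V = \bigcup_(j : 'I_N.+1)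
    [set w : Om | (w k).1 = j /\ V (w k).2].
  by apply/seteqP; split => [w Vw|w [j _ []]]//; exists (w k).1.
rewrite bigcup_ord; apply: bigsetU_measurable => j _.
exact: measurable_sojourn.
Qed.

End path_space.

Section switching_chain.
Context {R : realType} {N : nat}.
Notation Om := (Omega R N).
Variables (M : 'M[R]_N.+1) (p : 'rV[R]_N.+1).
Variables (mu : 'I_N.+1 -> probability R R) (P : probability Om R).
Hypotheses (M_stochastic : right_stochastic M) (M_irreducible : irreducible_mx M).
Hypothesis p_invariant : invariant_probability M p.
Hypothesis P_law : switching_law M p mu P.

Notation shift := (@shift_path R N : Om -> Om).

Definition pr (A : set Om) : R := fine (P A).

Lemma prE A : measurable A -> P A = (pr A)%:E.
Proof. by move=> mA; rewrite fineK// fin_num_measure. Qed.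

Lemma pr_ge0 A : 0 <= pr A.
Proof. by rewrite fine_ge0. Qed.

Lemma expr_mx_ge0 k i j : 0 <= (M ^+ k) i j.
Proof.
elim: k i j => [|k IH] i j; first by rewrite expr0 mxE; case: eqP.
rewrite exprS -mulmxE mxE sumr_ge0// => l _.
by rewrite mulr_ge0//; case: M_stochastic.
Qed.

(** Some mode is charged, and irreducibility carries mass from it to [j] through a power of [M]. *)
Lemma invariant_probability_gt0 j : 0 < p 0 j.
Proof.
have [p0 p1 pM] := p_invariant.
have pMk k : p *m M ^+ k = p.
  elim: k => [|k IH]; first by rewrite expr0 mulmx1.
  by rewrite exprS -mulmxE mulmxA pM.
have [i pi] : exists i, 0 < p 0 i.
  apply: contrapT => np; have := p1.
  rewrite big1 => [/eqP|i _]; first by rewrite eq_sym oner_eq0.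
  by apply/eqP; rewrite eq_le p0 andbT leNgt; apply/negP => pi; apply: np; exists i.
have [k Mk] := M_irreducible i j.
rewrite -(pMk k) mxE (bigD1 i)//= ltr_wpDr ?mulr_gt0// sumr_ge0// => l _.
by rewrite mulr_ge0 ?expr_mx_ge0.
Qed.

(** Maximum principle: at a maximal mode the averages of h i0 - h under the powers of [M] vanish,
    and irreducibility gives each mode a positive weight in one of them. *)
Lemma harmonic_constant (h : 'I_N.+1 -> R) :
  (forall i, h i = \sum_j M i j * h j) -> forall i j, h i = h j.
Proof.
move=> hM.
pose H := \col_j h j.
have MH k : M ^+ k *m H = H.
  elim: k => [|k IH]; first by rewrite expr0 mul1mx.
  rewrite exprSr -mulmxE -mulmxA (_ : M *m H = H)//.
  apply/matrixP => i l; rewrite ord1 !mxE [RHS]hM.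
  by apply: eq_bigr => j _; rewrite mxE.
have M1 k i : \sum_j (M ^+ k) i j = 1.
  elim: k i => [|k IH] i.
    by rewrite expr0 (bigD1 i)//= mxE eqxx big1 ?addr0// => j ji; rewrite mxE eq_sym (negPf ji).
  rewrite exprSr -mulmxE; under eq_bigr do rewrite mxE.
  rewrite exchange_big/= -[RHS](IH i); apply: eq_bigr => l _.
  by rewrite -mulr_sumr; case: M_stochastic => _ ->; rewrite mulr1.
have [i0 i0max] : exists i0, forall j, h j <= h i0.
  by case: (arg_maxP (P := predT) h (i0 := ord0) isT) => i0 _ H0; exists i0 => j; exact: H0.
suff hi0 j : h j = h i0 by move=> i j; rewrite !hi0.
have [k Mk] := M_irreducible i0 j.
have : \sum_l (M ^+ k) i0 l * (h i0 - h l) = 0.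
  under eq_bigr do rewrite mulrBr.
  rewrite sumrB -mulr_suml M1 mul1r.
  have /matrixP/(_ i0 0) := MH k; rewrite mxE [RHS]mxE => <-.
  by apply/eqP; rewrite subr_eq0; apply/eqP; apply: eq_bigr => l _; rewrite mxE.
move/eqP; rewrite psumr_eq0; last first.
  by move=> l _; rewrite mulr_ge0 ?expr_mx_ge0// subr_ge0.
move=> /allP/(_ j (mem_index_enum _)) /=.
by rewrite mulf_eq0 (gt_eqF Mk)/= subr_eq0 => /eqP ->.
Qed.

Lemma pr_cylinder n i U : (forall k, measurable (U k)) ->
  pr (cylinder n.+1 i U) = p 0 (i 0%N) * \prod_(k < n) M (i k) (i k.+1) *
    \prod_(k < n.+1) fine (mu (i k) (U k)).
Proof.
move=> mU; rewrite /pr P_law//.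
have -> : (\prod_(k < n.+1) mu (i k) (U k))%E =
    (\prod_(k < n.+1) fine (mu (i k) (U k)))%:E.
  rewrite -prodEFin; apply: eq_bigr => k _.
  by rewrite fineK// fin_num_measure.
by [].
Qed.

Lemma pr_first_sojourn j V : measurable V ->
  pr (first_sojourn j V) = p 0 j * fine (mu j V).
Proof.
by move=> mV; rewrite first_sojournE pr_cylinder// big_ord0 mulr1 big_ord_recl big_ord0 mulr1.
Qed.

Lemma fine_mu_setT j : fine (mu j setT) = 1.
Proof. by rewrite probability_setT. Qed.

Lemma pr_markov_cylinder i V j n i' U' : measurable V ->
  (forall k, measurable (U' k)) -> i' 0%N = j ->
  p 0 j * pr (first_sojourn i V `&` shift @^-1` cylinder n.+1 i' U') =
  p 0 i * M i j * fine (mu i V) * pr (cylinder n.+1 i' U').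
Proof.
move=> mV mU' i'j.
pose i2 k := if k is k'.+1 then i' k' else i.
pose U2 k := if k is k'.+1 then U' k' else V.
have := @cylinderS R N n.+1 i2 U2; rewrite /= => <-.
have mU2 k : measurable (U2 k) by case: k.
rewrite !pr_cylinder// big_ord_recl/= [\prod_(k < n.+2) _]big_ord_recl/= i'j.
ring.
Qed.

Lemma measure_unique_cylinders (m1 m2 : {measure set Om -> \bar R}) :
  (m1 setT < +oo)%E ->
  (forall n i U, (forall k, measurable (U k)) ->
    m1 (cylinder n i U) = m2 (cylinder n i U)) ->
  forall A, measurable A -> m1 A = m2 A.
Proof.
move=> m1T m12 A mA.
apply: (@measure_unique _ R Om (@cylinders R N) (fun=> setT) _ _ _ _ m1 m2) => //.
- exact: setI_closed_cylinders.
- move=> _; exists 0%N, (fun=> ord0), (fun=> setT); split => //.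
  by rewrite cylinder0.
- by rewrite bigcup_const.
- by move=> _ [n [i [U [mU ->]]]]; exact: m12.
Qed.

(** Markov property at the first jump, cross-multiplied by [p 0 j]. Both sides are finite measures
    in [A] that agree on cylinders. *)
Lemma pr_markov i V j A : measurable V -> measurable A ->
  p 0 j * pr (first_sojourn i V `&` shift @^-1` (first_sojourn j setT `&` A)) =
  p 0 i * M i j * fine (mu i V) * pr (first_sojourn j setT `&` A).
Proof.
move=> mV mA.
have mj : measurable (first_sojourn j setT : set Om) by exact: measurable_first_sojourn.
have mi : measurable (first_sojourn i V : set Om) by exact: measurable_first_sojourn.
have pj0 : 0 <= p 0 j by exact/ltW/invariant_probability_gt0.
have c0 : 0 <= p 0 i * M i j * fine (mu i V).
  rewrite !mulr_ge0 ?fine_ge0//; first exact/ltW/invariant_probability_gt0.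
  by case: M_stochastic.
have mij : measurable (first_sojourn i V `&` shift @^-1` first_sojourn j setT).
  by apply: measurableI => //; exact: measurable_preimage_shift.
pose m1f : {measure set Om -> \bar R} :=
  mscale (NngNum pj0) (pushforward (mrestr P mij) shift).
pose m1 := m1f measurable_shift.
pose m2 : {measure set Om -> \bar R} := mscale (NngNum c0) (mrestr P mj).
have mBA (B : set Om) : measurable B -> measurable (first_sojourn i V `&`
    shift @^-1` (first_sojourn j setT `&` B)).
  move=> mB; apply: measurableI => //; apply: measurable_preimage_shift.
  exact: measurableI.
have m1E (B : set Om) : measurable B -> m1 B = (p 0 j * pr (first_sojourn i V `&`
    shift @^-1` (first_sojourn j setT `&` B)))%:E.
  move=> mB; rewrite EFinM -prE; last exact: mBA.
  congr (_ * P _)%E; rewrite preimage_setI.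
  by rewrite setIC -setIA.
have m2E (B : set Om) : measurable B -> m2 B = (p 0 i * M i j * fine (mu i V) *
    pr (first_sojourn j setT `&` B))%:E.
  move=> mB; rewrite EFinM -prE; last exact: measurableI.
  by rewrite setIC.
suff : m1 A = m2 A by rewrite m1E// m2E// => -[].
apply: measure_unique_cylinders => //.
  by rewrite m1E// ltry.
move=> n i' U mU; have mC : measurable (cylinder n i' U : set Om) by exact: measurable_cylinder.
rewrite m1E// m2E//; congr EFin.
case: n mC => [|n] mC.
  rewrite cylinder0 setIT (first_sojournE j).
  exact: pr_markov_cylinder.
have [i'j|i'j] := eqVneq (i' 0%N) j.
  have -> : first_sojourn j setT `&` cylinder n.+1 i' U = cylinder n.+1 i' U.
    by apply/setIidr => w; rewrite cylinderS -i'j => -[[]].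
  exact: pr_markov_cylinder.
have -> : first_sojourn j setT `&` cylinder n.+1 i' U = set0.
  rewrite cylinderS; apply/seteqP; split => // w [[wj _] [[wi' _] _]].
  by move: i'j; rewrite -wj -wi' eqxx.
by rewrite preimage_set0 setI0 /pr measure0/= !mulr0.
Qed.

Lemma pr_partition (f : Om -> 'I_N.+1) (A : set Om) : measurable A ->
  (forall j, measurable (f @^-1` [set j])) ->
  pr A = \sum_j pr (f @^-1` [set j] `&` A).
Proof.
move=> mA mf.
have mF j : measurable (f @^-1` [set j] `&` A) by exact: measurableI.
have AE : A = \big[setU/set0]_j (f @^-1` [set j] `&` A).
  rewrite -bigcup_ord; apply/seteqP; split => [w Aw|w [j _ []]//].
  by exists (f w).
rewrite {1}AE /pr measure_semi_additive_ord//.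
- by rewrite -sum_fine// => j _; rewrite fin_num_measure.
- move=> j k _ _ [w [[/= <- _] [/= <- _]]]; by [].
- by rewrite -AE.
Qed.

Lemma first_sojourn_preimage j :
  (fun w : Om => (w 0%N).1) @^-1` [set j] = first_sojourn j setT.
Proof. by apply/seteqP; split => w //= -[]. Qed.

Lemma pr_partition_first A : measurable A ->
  pr A = \sum_j pr (first_sojourn j setT `&` A).
Proof.
move=> mA; rewrite (pr_partition mA (f := fun w => (w 0%N).1)).
  by apply: eq_bigr => j _; rewrite first_sojourn_preimage.
by move=> j; rewrite first_sojourn_preimage; exact: measurable_first_sojourn.
Qed.

(** Total probability over the second mode; the quotient is the conditional probability of [A] given
    the first mode. *)
Lemma pr_markov_sum i V A : measurable V -> measurable A ->
  pr (first_sojourn i V `&` shift @^-1` A) = p 0 i * fine (mu i V) *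
    \sum_j M i j * (pr (first_sojourn j setT `&` A) / p 0 j).
Proof.
move=> mV mA; have mi : measurable (first_sojourn i V : set Om).
  exact: measurable_first_sojourn.
rewrite (@pr_partition (fun w => (w 1%N).1)); last 2 first.
- by apply: measurableI => //; exact: measurable_preimage_shift.
- move=> j; exact: measurable_mode.
rewrite mulr_sumr; apply: eq_bigr => j _.
have pj0 := invariant_probability_gt0 j.
apply: (mulfI (lt0r_neq0 pj0)).
rewrite [RHS](_ : _ = p 0 i * M i j * fine (mu i V) *
  pr (first_sojourn j setT `&` A)); last by field; rewrite gt_eqF.
rewrite -pr_markov//; congr (_ * pr _).
by apply/seteqP; split => w /=; [move=> [wj [wi wA]]|move=> [wi [[wj _] wA]]].
Qed.

(** Stationarity: by invariance of [p], the second mode has the law of the first. *)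
Lemma pr_shift A : measurable A -> pr (shift @^-1` A) = pr A.
Proof.
move=> mA; have [_ p1 pM] := p_invariant.
rewrite pr_partition_first; last exact: measurable_preimage_shift.
under eq_bigr do rewrite pr_markov_sum// fine_mu_setT mulr1 mulr_sumr.
rewrite exchange_big/= [RHS]pr_partition_first//; apply: eq_bigr => j _.
have pj0 := invariant_probability_gt0 j.
under eq_bigr do rewrite mulrA.
rewrite -mulr_suml (_ : \sum_i _ = p 0 j); first by rewrite mulrC divfK// gt_eqF.
by rewrite -[in RHS]pM mxE.
Qed.

(* The conditional probability of A given the first mode is M-harmonic, hence
   constant; the Markov property then makes A independent of every cylinder, and
   so of itself. *)
Lemma zero_one_law A : measurable A -> shift @^-1` A = A -> pr A = 0 \/ pr A = 1.
Proof.
move=> mA SA; have [_ p1 _] := p_invariant.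
have pj0 j := invariant_probability_gt0 j.
pose h j := pr (first_sojourn j setT `&` A) / p 0 j.
have hM i : h i = \sum_j M i j * h j.
  rewrite /h -{1}SA pr_markov_sum// fine_mu_setT mulr1.
  by rewrite mulrC mulKf// gt_eqF.
have hc := harmonic_constant hM.
have hA j : pr (first_sojourn j setT `&` A) = p 0 j * pr A.
  rewrite [X in _ * X]pr_partition_first//.
  have hk k : pr (first_sojourn k setT `&` A) = p 0 k * h k.
    by rewrite mulrC divfK// gt_eqF.
  under eq_bigr do rewrite hk (hc _ j).
  by rewrite -mulr_suml p1 mul1r hk.
have indep n i U : (forall k, measurable (U k)) ->
    pr (cylinder n i U `&` A) = pr A * pr (cylinder n i U).
  move=> mU; case: n => [|n].
    by rewrite cylinder0 setTI /pr probability_setT mulr1.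
  elim: n i U mU => [|n IH] i U mU.
    rewrite cylinderS cylinder0 preimage_setT setIT -{1}SA pr_markov_sum//.
    rewrite pr_first_sojourn// mulrC; congr (_ * _).
    under eq_bigr do rewrite hA mulrAC mulfV ?gt_eqF// mul1r.
    by rewrite -mulr_suml; case: M_stochastic => _ ->; rewrite mul1r.
  pose i' k := i k.+1; pose U' k := U k.+1.
  have mU' k : measurable (U' k) by exact: mU.
  have mC : measurable (cylinder n.+1 i' U' : set Om) by exact: measurable_cylinder.
  have jC : first_sojourn (i' 0%N) setT `&` cylinder n.+1 i' U' = cylinder n.+1 i' U'.
    by apply/setIidr => w; rewrite cylinderS => -[[]].
  set F := first_sojourn (i 0%N) (U 0%N); set C := cylinder n.+1 i' U' in mC jC *.
  have FC (B : set Om) : measurable B -> p 0 (i' 0%N) * pr (F `&` shift @^-1` (C `&` B)) =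
      p 0 (i 0%N) * M (i 0%N) (i' 0%N) * fine (mu (i 0%N) (U 0%N)) * pr (C `&` B).
    have -> : C `&` B = first_sojourn (i' 0%N) setT `&` (C `&` B) by rewrite setIA jC.
    by move=> mB; apply: pr_markov => //; exact: measurableI.
  have := FC setT measurableT; rewrite !setIT => FCT.
  rewrite cylinderS -/i' -/U' -/C -/F; apply: (mulfI (lt0r_neq0 (pj0 (i' 0%N)))).
  have -> : F `&` shift @^-1` C `&` A = F `&` shift @^-1` (C `&` A).
    by rewrite preimage_setI SA setIA.
  by rewrite FC// mulrCA FCT IH//; ring.
have prA0 : 0 <= pr A by exact: pr_ge0.
pose m1 : {measure set Om -> \bar R} := mrestr P mA.
pose m2 : {measure set Om -> \bar R} := mscale (NngNum prA0) P.
have : m1 A = m2 A.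
  apply: measure_unique_cylinders => //.
    by rewrite /m1/= /mrestr prE ?ltry//; exact: measurableI.
  move=> n i U mU; have mC : measurable (cylinder n i U : set Om) by exact: measurable_cylinder.
  rewrite /m1 /m2/= /mrestr /mscale/= [in LHS]prE; last exact: measurableI.
  by rewrite (prE mC) indep// EFinM.
rewrite /m1 /m2/= /mrestr /mscale/= setIid prE// -EFinM => -[] /eqP.
rewrite -[X in X == _]mulr1 -subr_eq0 -mulrBr mulf_eq0 subr_eq0 => /orP[/eqP|/eqP <-]; [left|right] => //.
Qed.

End switching_chain.

(** * Birkhoff sums *)

Section measurability_by_mode.
Context {R : realType} {N : nat}.
Notation Om := (Omega R N).

Lemma measurable_fun_mode k (g : 'I_N.+1 -> Om -> R) :
  (forall j, measurable_fun [set: Om] (g j)) ->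
  measurable_fun [set: Om] (fun w => g (w k).1 w).
Proof.
move=> mg _ V mV; rewrite setTI.
have -> : (fun w : Om => g (w k).1 w) @^-1` V = \bigcup_(j : 'I_N.+1)
    ([set w : Om | (w k).1 = j] `&` (g j @^-1` V)).
  apply/seteqP; split => [w Vw|w [j _ [/= <-]]]//.
  by exists (w k).1.
rewrite bigcup_ord; apply: bigsetU_measurable => j _; apply: measurableI.
  exact: measurable_mode.
by rewrite -[X in measurable X]setTI; exact: mg.
Qed.

End measurability_by_mode.

Section ergodic.
Context {R : realType} {N : nat}.
Notation Om := (Omega R N).
Variables (M : 'M[R]_N.+1) (p : 'rV[R]_N.+1).
Variables (mu : 'I_N.+1 -> probability R R) (P : probability Om R).
Hypotheses (M_stochastic : right_stochastic M) (M_irreducible : irreducible_mx M).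
Hypothesis p_invariant : invariant_probability M p.
Hypothesis P_law : switching_law M p mu P.

Notation shift := (@shift_path R N : Om -> Om).

Lemma P_shift (A : set Om) : measurable A -> P (shift @^-1` A) = P A.
Proof.
move=> mA; have mSA := measurable_preimage_shift mA.
rewrite (prE P mSA) (prE P mA); congr EFin.
exact: (pr_shift M_stochastic M_irreducible p_invariant P_law).
Qed.

Lemma ge0_integral_shift (f : Om -> \bar R) : measurable_fun [set: Om] f ->
  (forall w, (0 <= f w)%E) ->
  (\int[P]_w f (shift w) = \int[P]_w f w)%E.
Proof.
move=> mf f0.
have := @ge0_integral_pushforward _ _ Om Om R shift measurable_shift P setT f measurableT mf.
rewrite preimage_setT => <-; last by move=> w _; exact: f0.
apply: eq_measure_integral => [|mS A mA _]; first exact: measurable_shift.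
exact: P_shift.
Qed.

Lemma integrable_shift (f : Om -> R) :
  P.-integrable setT (EFin \o f) -> P.-integrable setT (EFin \o (f \o shift)).
Proof.
move=> /integrableP[mf fi]; apply/integrableP; split.
  by apply: measurableT_comp mf _; exact: measurable_shift.
by rewrite (ge0_integral_shift (f := fun w => `|(f w)%:E|%E))//; exact: measurableT_comp.
Qed.

Lemma Rintegral_shift (f : Om -> R) : P.-integrable setT (EFin \o f) ->
  \int[P]_w f (shift w) = \int[P]_w f w.
Proof.
move=> fi; rewrite /Rintegral; congr fine.
have mf := measurable_int P fi.
have := @integral_pushforward _ _ Om Om R shift measurable_shift P setT (EFin \o f) mf.
rewrite preimage_setT => /(_ (integrable_shift fi) measurableT) <-.
apply: eq_measure_integral => [|mS A mA _]; first exact: measurable_shift.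
exact: P_shift.
Qed.

Variable f : Om -> R.
Hypothesis fi : P.-integrable setT (EFin \o f).

(* The maximum of the Birkhoff sums of length 0, ..., n. *)
Fixpoint max_birkhoff n w : R :=
  if n is n'.+1 then Num.max 0 (f w + max_birkhoff n' (shift w)) else 0.

Lemma max_birkhoff_ge0 n w : 0 <= max_birkhoff n w.
Proof. by case: n => //= n; rewrite le_max lexx. Qed.

Lemma max_birkhoff_nondecreasing n w : max_birkhoff n w <= max_birkhoff n.+1 w.
Proof.
elim: n w => [|n IH] w; first by rewrite /= le_max lexx.
rewrite [leLHS]/= [leRHS]/= -/(max_birkhoff n.+1 (shift w)).
by rewrite le_max2 ?lexx// lerD2l IH.
Qed.

Lemma max_birkhoff_le n m w : (n <= m)%N -> max_birkhoff n w <= max_birkhoff m w.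
Proof.
move=> /subnKC <-; elim: (m - n)%N => [|k IH]; first by rewrite addn0.
by rewrite addnS (le_trans IH)// max_birkhoff_nondecreasing.
Qed.

Lemma birkhoff_le n w : \sum_(k < n) f (iter k shift w) <= max_birkhoff n w.
Proof.
elim: n w => [|n IH] w; first by rewrite big_ord0.
rewrite big_ord_recl /= le_max; apply/orP; right; rewrite lerD2l.
under eq_bigr do rewrite -iterS iterSr.
exact: IH.
Qed.

Lemma measurable_max_birkhoff n : measurable_fun setT (max_birkhoff n).
Proof.
have mf : measurable_fun setT f by apply/measurable_EFinP; exact: measurable_int fi.
elim: n => [|n IH]; first exact: measurable_cst.
apply: (@measurable_maxr _ _ _ _ (cst 0) (fun w => f w + max_birkhoff n (shift w))) => //.
by apply: measurable_funD => //; apply: measurableT_comp IH _; exact: measurable_shift.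
Qed.

Lemma integrable_max_birkhoff n : P.-integrable setT (EFin \o max_birkhoff n).
Proof.
elim: n => [|n IH]; first exact: integrable0.
apply: (@le_integrable _ _ _ P setT measurableT _
  (fun w => `|(f w)%:E| + (max_birkhoff n (shift w))%:E)%E).
- by apply/measurable_EFinP; exact: (measurable_max_birkhoff n.+1).
- move=> w _.
  rewrite -[leLHS]/((`|max_birkhoff n.+1 w|)%:E).
  rewrite -[leRHS]/((`| `|f w| + max_birkhoff n (shift w)|)%:E) lee_fin.
  rewrite (ger0_norm (max_birkhoff_ge0 n.+1 w)).
  rewrite (ger0_norm (_ : 0 <= `|f w| + max_birkhoff n (shift w))) ?addr_ge0 ?max_birkhoff_ge0//.
  rewrite /= ge_max addr_ge0 ?max_birkhoff_ge0//= lerD2r.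
  exact: ler_norm.
- apply: integrableD => //; first exact: integrable_abse fi.
  exact: integrable_shift IH.
Qed.

Definition unbounded_birkhoff : set Om :=
  [set w | forall C : nat, exists n, C%:R < max_birkhoff n w].

Lemma measurable_unbounded_birkhoff : measurable unbounded_birkhoff.
Proof.
have -> : unbounded_birkhoff = \bigcap_(C : nat) \bigcup_(n : nat)
    (max_birkhoff n @^-1` `]C%:R, +oo[).
  apply/seteqP; split => [w wI C _|w wI C].
    by have [n Cn] := wI C; exists n => //=; rewrite in_itv/= andbT.
  by have [n _] := wI C I; rewrite /= in_itv/= andbT => Cn; exists n.
apply: bigcapT_measurable => C; apply: bigcupT_measurable => n.
by rewrite -[X in measurable X]setTI; exact: measurable_max_birkhoff.
Qed.

(** From [w] to its shift the maxima change by at most the fixed amount [f w], up to one index and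
    the floor at 0. *)
Lemma unbounded_birkhoff_shift :
  shift @^-1` unbounded_birkhoff = unbounded_birkhoff.
Proof.
apply/seteqP; split => [w wI C|w wI C].
  have [n Cn] := wI (Num.bound (C%:R + `|f w|)).
  exists n.+1; rewrite /= lt_max; apply/orP; right.
  have /archi_boundP h : 0 <= C%:R + `|f w| by rewrite addr_ge0.
  have h' := lt_trans h Cn; have := ler_norm (- f w).
  by rewrite normrN => h''; lra.
have [n Cn] := wI (Num.bound (C%:R + `|f w|)).
have /archi_boundP h : 0 <= C%:R + `|f w| by rewrite addr_ge0.
have h' := lt_trans h Cn.
case: n {Cn} h' => [|n] /=.
  by rewrite ltNge addr_ge0.
rewrite lt_max ltNge addr_ge0//= => h'.
by exists n; have := ler_norm (f w); lra.
Qed.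

(* Garsia's argument: if the maxima are unbounded, then
   max_birkhoff n.+1 - max_birkhoff n \o shift converges boundedly to f,
   although it has a nonnegative integral. *)
Lemma bounded_birkhoff : \int[P]_w f w < 0 ->
  {ae P, forall w, exists C : R, forall n,
    \sum_(k < n) f (iter k shift w) <= C}.
Proof.
move=> f0.
have mI := measurable_unbounded_birkhoff.
have mf : measurable_fun setT f by apply/measurable_EFinP; exact: measurable_int fi.
have [I0|I1] := zero_one_law M_stochastic M_irreducible p_invariant P_law mI unbounded_birkhoff_shift.
  exists unbounded_birkhoff; split => //; first by rewrite prE// I0.
  move=> w /= nb; apply: contrapT => nI; apply: nb.
  move: nI => /existsNP[C /forallNP nC]; exists C%:R => n.
  rewrite (le_trans (birkhoff_le n w))// leNgt; apply/negP; exact: nC.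
pose g n w := max_birkhoff n.+1 w - max_birkhoff n (shift w).
have gi n : P.-integrable setT (EFin \o g n).
  have := @integrableB _ _ _ P setT measurableT _ _ (integrable_max_birkhoff n.+1)
    (integrable_shift (integrable_max_birkhoff n)).
  by apply: eq_integrable => // w _; rewrite /= -EFinB.
(* In this form the difference is dominated by the modulus of [f], and it equals [f w] as soon as
   the maximum along the shifted path exceeds that modulus. *)
have gE n w : g n w = Num.max (- max_birkhoff n (shift w)) (f w).
  rewrite /g /=; set m := max_birkhoff n _.
  by case: (leP 0 (f w + m)); case: (leP (- m) (f w)) => *; lra.
have gf n w : `|g n w| <= `|f w|.
  rewrite gE; have m0 := max_birkhoff_ge0 n (shift w).
  case: (leP (f w) (- max_birkhoff n (shift w))) => h //.
  by rewrite normrN ger0_norm// ler_normr; apply/orP; right; rewrite lerNr.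
have ng : negligible P (~` unbounded_birkhoff).
  exists (~` unbounded_birkhoff); split => //; first exact: measurableC.
  by rewrite probability_setC// prE// I1 -EFinB subrr.
have gcvg : {ae P, forall w, setT w -> (EFin \o g n) w @[n --> \oo] --> (EFin \o f) w}.
  apply: negligibleS ng => w /= nw wI; apply: nw => _.
  have [n0 n0P] := wI (Num.bound `|f w|).
  have SI : unbounded_birkhoff (shift w) by have := wI; rewrite -{1}unbounded_birkhoff_shift.
  have [m mP] := SI (Num.bound `|f w|).
  apply: cvg_near_cst; near=> n.
  have mn : (m <= n)%N by near: n; exact: nbhs_infty_ge.
  have h1 := max_birkhoff_le (shift w) mn.
  have /archi_boundP h2 := normr_ge0 (f w).
  rewrite /= gE; congr EFin; apply/max_idPr.
  have := ler_norm (- f w); rewrite normrN; lra.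
have gdom : {ae P, forall w n, setT w -> (`|(EFin \o g n) w| <= (EFin \o (fun w => `|f w|%R)) w)%E}.
  by apply: aeW => w n _; rewrite /= lee_fin gf.
have [_ _ H] := @dominated_convergence _ _ _ P setT measurableT (fun n => EFin \o g n)
  (EFin \o f) (EFin \o (fun w => `|f w|)) (fun n => measurable_int P (gi n))
  (measurable_int P fi) gcvg (integrable_norm fi) gdom.
(* By shift invariance the integral is that of [max_birkhoff n.+1] minus that of
   [max_birkhoff n]. *)
have g0 n : (0 <= \int[P]_w (EFin \o g n) w)%E.
  rewrite -[X in (_ <= X)%E]fineK; last by apply: integrable_fin_num => //; exact: gi.
  rewrite lee_fin.
  have -> : fine (\int[P]_w (EFin \o g n) w)%E =
      \int[P]_w (max_birkhoff n.+1 w - max_birkhoff n (shift w)) by [].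
  rewrite RintegralB//; last 2 first.
  - exact: integrable_max_birkhoff.
  - exact/integrable_shift/integrable_max_birkhoff.
  rewrite Rintegral_shift; last exact: integrable_max_birkhoff.
  rewrite subr_ge0 le_Rintegral//; first exact: integrable_max_birkhoff.
    exact: integrable_max_birkhoff.
  by move=> w _; exact: max_birkhoff_nondecreasing.
have : (0 <= \int[P]_w (EFin \o f) w)%E.
  rewrite -(cvg_lim _ H)//; apply: lime_ge; first by apply/cvg_ex; eexists; exact: H.
  by apply: nearW => n; exact: g0.
move=> /(fine_ge0 (R := R)); rewrite -/(Rintegral P setT f) leNgt.
by rewrite f0.
Unshelve. all: by end_near. Qed.

End ergodic.

(** * Mean durations and divergence of the switching times *)

Section sojourn_moments.
Context {R : realType} {N : nat}.
Notation Om := (Omega R N).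
Variables (M : 'M[R]_N.+1) (p : 'rV[R]_N.+1).
Variables (mu : 'I_N.+1 -> probability R R) (P : probability Om R).
Hypotheses (M_stochastic : right_stochastic M) (M_irreducible : irreducible_mx M).
Hypothesis p_invariant : invariant_probability M p.
Hypothesis mu_pos : forall i, mu i `]0, +oo[%classic = 1%E.
Hypothesis mu_mean : forall i, (\int[mu i]_(t in `]0%R, +oo[) t%:E < +oo)%E.
Hypothesis P_law : switching_law M p mu P.

Notation shift := (@shift_path R N : Om -> Om).
Notation positive_first j := (first_sojourn j `]0, +oo[%classic : set Om).

(** This is p_j tau_j, the average time that one sojourn contributes to mode [j], rather than
    tau_j. *)
Definition mean_time j : R := \int[P]_(w in positive_first j) (w 0%N).2.

Let mD j : measurable (positive_first j).
Proof. by apply: measurable_first_sojourn; exact: measurable_itv. Qed.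

Lemma integrable_first_duration j :
  P.-integrable (positive_first j) (EFin \o (fun w : Om => (w 0%N).2)).
Proof.
have mX : measurable_fun [set: Om] (fun w : Om => (w 0%N).2) by exact: measurable_duration.
apply/integrableP; split.
  by apply/measurable_EFinP; exact: measurable_funTS.
(* The value -1 lies outside the positive half-line, so on that half-line the image of P under [phi]
   is p_j mu_j. *)
pose phi (w : Om) : R := if (w 0%N).1 == j then (w 0%N).2 else -1.
have mphi : measurable_fun [set: Om] phi.
  apply: (@measurable_fun_mode _ _ 0%N (fun i (w : Om) => if i == j then (w 0%N).2 else -1)).
  by move=> i; case: (i == j); [exact: measurable_duration|exact: measurable_cst].
have phiD (V : set R) : V `<=` `]0, +oo[%classic -> phi @^-1` V = first_sojourn j V.
  move=> V0; apply/seteqP; split => w /=; rewrite /phi; last by move=> [-> ?]; rewrite eqxx.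
  by case: eqP => [wj Vw|_ /V0]; rewrite /= ?in_itv/= ?andbT ?oppr_gt0 ?ltr10.
have pj0 : 0 <= p 0 j by case: p_invariant.
have D0 : measurable (`]0, +oo[%classic : set R) by exact: measurable_itv.
have mid : measurable_fun (`]0, +oo[%classic : set R) (EFin \o (@idfun R)).
  by apply/measurable_EFinP; exact: measurable_id.
have idge0 : {in (`]0, +oo[%classic : set R), forall y : R, (0 <= (EFin \o (@idfun R)) y)%E}.
  by move=> y; rewrite inE/= in_itv/= andbT lee_fin => /ltW.
have := @ge0_integral_pushforward _ _ Om R R phi mphi P `]0, +oo[%classic _ D0 mid idge0.
rewrite phiD// => H.
rewrite (eq_integral (EFin \o (@idfun R) \o phi)); last first.
  move=> w; rewrite inE => -[/= wj w0]; rewrite /phi wj eqxx ger0_norm//.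
  by move: w0; rewrite in_itv/= andbT => /ltW.
rewrite -H (@eq_measure_integral _ _ _ _ (mscale (NngNum pj0) (mu j))); last first.
  move=> A mA A0; rewrite /= /pushforward phiD//.
  have mA' : measurable (first_sojourn j A : set Om) by exact: measurable_first_sojourn.
  rewrite (prE P mA') (pr_first_sojourn P_law)// EFinM /mscale/=; congr (_ * _)%E.
  by rewrite fineK// fin_num_measure.
rewrite ge0_integral_mscale//; last first.
  by move=> y; rewrite /= in_itv/= andbT lee_fin => /ltW.
apply: lte_mul_pinfty => //; exact: mu_mean.
Qed.

(** The integrand is positive on an event of probability p_j > 0. *)
Lemma mean_time_gt0 j : 0 < mean_time j.
Proof.
have pj0 := invariant_probability_gt0 M_stochastic M_irreducible p_invariant j.
have X0 (w : Om) : positive_first j w -> 0 < (w 0%N).2.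
  by move=> [_ /=]; rewrite in_itv/= andbT.
rewrite lt_neqAle Rintegral_ge0 ?andbT; last by move=> w /X0 /ltW.
rewrite eq_sym; apply/eqP => T0.
have fi := integrable_first_duration j.
have I0 : (\int[P]_(w in positive_first j) `|((w 0%N).2)%:E| = 0)%E.
  rewrite (eq_integral (fun w : Om => ((w 0%N).2)%:E)); last first.
    by move=> w; rewrite inE => /X0 w0; rewrite /= ger0_norm// ltW.
  rewrite -[LHS]fineK; last exact: (@integrable_fin_num _ _ _ P _ (mD j) _ fi).
  by congr EFin; exact: T0.
have /(ae_eq_integral_abs P (mD j) (measurable_int P fi)).1 := I0.
move=> [Z [mZ Z0 subZ]].
have : (P (positive_first j) <= 0)%E.
  rewrite -Z0; apply: le_measure; rewrite ?inE// => w wD.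
  apply: subZ => /= h; have := h wD => -[] w0.
  by have := X0 w wD; rewrite w0 ltxx.
rewrite (prE P (mD j)) (pr_first_sojourn P_law)//.
by rewrite mu_pos mulr1 lee_fin leNgt pj0.
Qed.

Lemma bounded_affine_birkhoff (a b : 'I_N.+1 -> R) :
  \sum_j (a j * mean_time j + b j * p 0 j) < 0 ->
  {ae P, forall w : Om, (forall k, 0 < (w k).2) -> exists C : R, forall n,
    \sum_(k < n) (a (w k).1 * (w k).2 + b (w k).1) <= C}.
Proof.
move=> ab0.
(* The duration is cut off to positive values, where its integrability is known; [f] agrees with the
   affine function whenever the first duration is positive. *)
pose D j := (fun w : Om => (w 0%N).2) \_ (positive_first j).
pose I j : Om -> R := \1_(first_sojourn j setT).
pose f (w : Om) := \sum_j (a j * D j w + b j * I j w).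
have Di j : P.-integrable setT (EFin \o D j).
  have := (integrable_mkcond (EFin \o (fun w : Om => (w 0%N).2)) (mD j)).1 (integrable_first_duration j).
  by rewrite restrict_EFin.
have mj j : measurable (first_sojourn j setT : set Om) by exact: measurable_first_sojourn.
have Ii j : P.-integrable setT (EFin \o I j) by exact: integrable_indic.
have aDi j : P.-integrable setT (EFin \o (fun w => a j * D j w)).
  exact: (@integrableZl _ _ _ P setT measurableT (a j) _ (Di j)).
have bIi j : P.-integrable setT (EFin \o (fun w => b j * I j w)).
  exact: (@integrableZl _ _ _ P setT measurableT (b j) _ (Ii j)).
have si j : P.-integrable setT (EFin \o (fun w => a j * D j w + b j * I j w)).
  exact: (@integrableD _ _ _ P setT measurableT _ _ (aDi j) (bIi j)).
have [fi fE] := Rintegral_sum measurableT si.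
have fE' : \int[P]_w f w = \sum_j (a j * mean_time j + b j * p 0 j).
  rewrite fE; apply: eq_bigr => j _.
  rewrite RintegralD// !RintegralZl//; congr (_ * _ + _ * _).
    by rewrite /mean_time [RHS]Rintegral_mkcond.
  rewrite /Rintegral integral_indic// setIT -/(pr P _) (pr_first_sojourn P_law)//.
  by rewrite probability_setT mulr1.
have fw (w : Om) : 0 < (w 0%N).2 -> f w = a (w 0%N).1 * (w 0%N).2 + b (w 0%N).1.
  move=> w0; rewrite /f (bigD1 (w 0%N).1)//= big1 ?addr0.
    rewrite /D /I indicE patchE !mem_set ?mulr1//.
    by split => //=; rewrite in_itv/= andbT.
  move=> j jw; rewrite /D /I indicE patchE !memNset ?mulr0 ?addr0//.
    by move=> [/= wj _]; move: jw; rewrite wj eqxx.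
  by move=> [/= wj _]; move: jw; rewrite wj eqxx.
have := bounded_birkhoff M_stochastic M_irreducible p_invariant P_law fi.
rewrite fE' => /(_ ab0); apply: filterS => w [C CP] w0; exists C => n.
rewrite (le_trans _ (CP n))//; apply: ler_sum => k _.
have -> : iter k shift w = fun l => w (k + l)%N.
  elim: {C CP}(nat_of_ord k) => [|m IH]; first by apply/funext => l.
  by rewrite iterS IH; apply/funext => l; rewrite /shift_path addSnnS.
by have := fw (fun l => w (k + l)%N); rewrite /f/= addn0 => ->.
Qed.

(** Nonpositive durations are excluded at the first step by the law, then at all steps by
    stationarity. For divergence, the sums of e - t_k are bounded above, so s_n is at least e n -
    C. *)
Lemma ae_regular : {ae P, forall w : Om, regular w}.
Proof.
have pos k : {ae P, forall w : Om, 0 < (w k).2}.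
  have mA l : measurable [set w : Om | (w l).2 <= 0].
    have -> : [set w : Om | (w l).2 <= 0] = (fun w : Om => (w l).2) @^-1` `]-oo, 0].
      by apply/seteqP; split => w; rewrite /= in_itv.
    rewrite -[X in measurable X]setTI.
    by apply: measurable_duration => //; exact: measurable_itv.
  exists [set w : Om | (w k).2 <= 0]; split; first exact: mA.
    elim: k => [|k IH].
      have -> : [set w : Om | (w 0%N).2 <= 0] =
          ~` \big[setU/set0]_j (first_sojourn j `]0, +oo[%classic : set Om).
        rewrite -bigcup_ord; apply/seteqP; split => w /=.
          by move=> w0 [j _ [_ /=]]; rewrite in_itv/= andbT ltNge w0.
        move=> nw; rewrite leNgt; apply/negP => w0; apply: nw.
        by exists (w 0%N).1 => //; split => //=; rewrite in_itv/= andbT.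
      have mU : measurable (\big[setU/set0]_j (first_sojourn j `]0, +oo[%classic : set Om)).
        by apply: bigsetU_measurable => j _; exact: mD.
      rewrite probability_setC// measure_semi_additive_ord//; last first.
        by move=> j k _ _ [w [[<- _] [<- _]]].
      rewrite (eq_bigr (fun j => (p 0 j)%:E)); last first.
        move=> j _; transitivity (P (positive_first j)) => //.
        rewrite (prE P (mD j)) (pr_first_sojourn P_law)//.
        by rewrite mu_pos mulr1.
      by rewrite sumEFin; case: p_invariant => _ -> _; rewrite -EFinB subrr.
    rewrite -[RHS]IH -[RHS](P_shift M_stochastic M_irreducible p_invariant P_law)//.
  by move=> w /= /negP; rewrite -leNgt.
have posall : {ae P, forall w : Om, forall k, 0 < (w k).2} by exact: ae_foralln.
(* Half the mean duration of a sojourn, so that e minus the duration has a negative mean. *)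
pose e := \sum_j mean_time j / 2.
have e0 : 0 < e.
  rewrite /e (bigD1 ord0)//= ltr_wpDr ?divr_gt0 ?mean_time_gt0// sumr_ge0// => j _.
  by rewrite divr_ge0// ltW ?mean_time_gt0.
have := @bounded_affine_birkhoff (fun=> -1) (fun=> e).
have -> : \sum_j (-1 * mean_time j + e * p 0 j) = - e.
  rewrite big_split/= -!mulr_sumr; case: p_invariant => _ -> _.
  by rewrite mulr1 /e -mulr_suml; lra.
rewrite oppr_lt0 => /(_ e0); apply: filterS2 posall => w wpos /(_ wpos)[C CP].
split => //; apply/cvgryPge => A; near=> n.
have := CP n; rewrite big_split/= -mulr_sumr -/(switch_time w n) sumr_const card_ord -mulr_natl.
have : (A + C) / e <= n%:R by near: n; exact: nbhs_infty_ger.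
by rewrite ler_pdivrMr//; lra.
Unshelve. all: by end_near. Qed.

End sojourn_moments.

(** * The maximal Lyapunov exponent *)

Section measurable_growth.
Context {R : realType} {N D : nat}.
Notation Om := (Omega R N).
Variable L : 'I_N.+1 -> 'M[R]_D.

Lemma measurable_mulmx a b c (F : Om -> 'M[R]_(a, b)) (G : Om -> 'M[R]_(b, c)) :
  (forall i j, measurable_fun [set: Om] (fun w => F w i j)) ->
  (forall i j, measurable_fun [set: Om] (fun w => G w i j)) ->
  forall i j, measurable_fun [set: Om] (fun w => (F w *m G w) i j).
Proof.
move=> mF mG i j; under eq_fun do rewrite mxE.
by apply: measurable_sum => k; apply: measurable_funM.
Qed.

Lemma measurable_expmx_sojourn n u i j : measurable_fun [set: Om]
  (fun w => expmx (L (w n).1) (u * (w n).2) i j).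
Proof.
apply: (@measurable_fun_mode _ _ n (fun k w => expmx (L k) (u * (w n).2) i j)) => k.
apply: (@measurableT_comp _ _ _ _ _ _ (fun t : R => expmx (L k) t i j)).
  by apply: continuous_measurable_fun; exact: continuous_expmx.
by apply: measurable_funM => //; exact: measurable_duration.
Qed.

Lemma measurable_transition n i j :
  measurable_fun [set: Om] (fun w => transition L w n i j).
Proof.
elim: n i j => [|n IH] i j; first exact: measurable_cst.
apply: measurable_mulmx => // k l.
have := measurable_expmx_sojourn n 1 k l.
by under eq_fun do rewrite mul1r.
Qed.

Lemma measurable_bounded_growth (c : R) :
  measurable [set w : Om | bounded_growth L c w].
Proof.
pose u (m k : nat) : R := k%:R / m.+1%:R.
pose F n m k (w : Om) := expmx (L (w n).1) (u m k * (w n).2) *m transition L w n.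
pose g n m k (C : nat) (w : Om) : R :=
  C%:R * expR (c * (switch_time w n + u m k * (w n).2)).
have mF n m k i j : measurable_fun [set: Om] (fun w => F n m k w i j).
  apply: measurable_mulmx; [exact: measurable_expmx_sojourn|exact: measurable_transition].
have mg n m k C : measurable_fun [set: Om] (g n m k C).
  apply: measurable_funM => //; apply: measurableT_comp => //.
  apply: measurable_funM => //; apply: measurable_funD.
    by apply: measurable_sum => l; exact: measurable_duration.
  by apply: measurable_funM => //; exact: measurable_duration.
have mE n m k C i j : measurable [set w | `|F n m k w i j| <= g n m k C w].
  have := @measurable_fun_ler _ _ _ setT _ _ (measurableT_comp (@normr_measurable R setT) (mF n m k i j)) (mg n m k C) measurableT [set true].
  by rewrite setTI => /(_ _)/=; apply.
have -> : [set w : Om | bounded_growth L c w] =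
    \bigcup_(C : nat) \bigcap_(n : nat) \bigcap_(m : nat) \bigcap_(k in [set k | (k <= m)%N])
      \bigcap_(i : 'I_D) \bigcap_(j : 'I_D) [set w | `|F n m k w i j| <= g n m k C w].
  apply/seteqP; split => w /=.
    move=> [C CP]; exists C => // n _ m _ k km i _ j _ /=.
    exact: le_trans (mx_entry_le _ _ _) (CP n m k km).
  move=> [C _ CP]; exists C => n m k km; apply: mx_norm_le => [|i j].
    by rewrite mulr_ge0 ?expR_ge0.
  exact: (CP n I m I k km i I j I).
apply: bigcupT_measurable => C; apply: bigcapT_measurable => n.
apply: bigcapT_measurable => m; apply: bigcap_measurable; first by exists 0%N.
move=> k km; apply: fin_bigcap_measurable => [|i _]; first exact: finite_finset.
by apply: fin_bigcap_measurable => [|j _]; [exact: finite_finset|exact: mE].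
Qed.

End measurable_growth.

Lemma ereal_rat_between (R : realType) (x y : \bar R) : (x < y)%E ->
  exists q : rat, (x < (ratr q)%:E)%E /\ ((ratr q)%:E < y)%E.
Proof.
case: x y => [x| |] [y| |] //=.
- rewrite lte_fin => /rat_in_itvoo[q]; rewrite in_itv/= => /andP[xq qy].
  by exists q; rewrite !lte_fin.
- move=> _; have /rat_in_itvoo[q] : x < x + 1 by rewrite ltrDl.
  by rewrite in_itv/= => /andP[xq _]; exists q; rewrite lte_fin ltry.
- move=> _; have /rat_in_itvoo[q] : y - 1 < y by rewrite ltrBlDr ltrDl.
  by rewrite in_itv/= => /andP[_ qy]; exists q; rewrite lte_fin ltNyr.
- by move=> _; exists 0; rewrite ltry ltNyr.
Qed.

Section maximal_exponent.
Context {R : realType} {N D : nat}.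
Notation Om := (Omega R N).
Variables (M : 'M[R]_N.+1) (p : 'rV[R]_N.+1).
Variables (mu : 'I_N.+1 -> probability R R) (P : probability Om R).
Hypotheses (M_stochastic : right_stochastic M) (M_irreducible : irreducible_mx M).
Hypothesis p_invariant : invariant_probability M p.
Hypothesis P_law : switching_law M p mu P.
Hypothesis P_regular : {ae P, forall w : Om, regular w}.
Variable L : 'I_N.+1 -> 'M[R]_D.
Hypothesis D_gt0 : (0 < D)%N.

Lemma ae_bounded_growth (c : R) :
  {ae P, forall w : Om, bounded_growth L c w} \/
  {ae P, forall w : Om, ~ bounded_growth L c w}.
Proof.
have mG := measurable_bounded_growth L c.
have SG : (@shift_path R N : Om -> Om) @^-1` [set w | bounded_growth L c w] =
    [set w : Om | bounded_growth L c w].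
  by apply/seteqP; split => w /=; rewrite bounded_growth_shift.
have [G0|G1] := zero_one_law M_stochastic M_irreducible p_invariant P_law mG SG.
  right; exists [set w : Om | bounded_growth L c w]; split => //.
    by rewrite prE// G0.
  by move=> w /contrapT.
left; exists (~` [set w : Om | bounded_growth L c w]); split => //.
  exact: measurableC.
by rewrite probability_setC// prE// G1 -EFinB subrr.
Qed.

(** The second conclusion is the way in which growth estimates bound the exponent, which is not
    known to be finite here. *)
Lemma exists_lambda_max : exists2 l : \bar R, is_lambda_max P L l &
  forall q : rat, {ae P, forall w : Om, bounded_growth L (ratr q) w} ->
    (l <= (ratr q)%:E)%E.
Proof.
have ae_filter : Filter (nbhs (almost_everywhere P)) := ae_filter_ringOfSetsType P.
pose Q := [set q : rat | {ae P, forall w : Om, bounded_growth L (ratr q) w}].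
pose l := ereal_inf [set ((ratr q)%:E : \bar R) | q in Q].
have lQ q : Q q -> (l <= (ratr q)%:E)%E.
  by move=> Qq; apply: ereal_inf_lbound; exists q.
exists l => //.
(* Enumerating the rationals gives one almost sure event on which every rational rate behaves as it
   does almost surely. *)
have : {ae P, forall w : Om, forall n, let q := odflt 0 (unpickle n) in
    Q q <-> bounded_growth L (ratr q) w}.
  apply: ae_foralln => n /=; set q := odflt _ _.
  have [Gq|nGq] := ae_bounded_growth (ratr q).
    by move: (Gq); apply: filterS => w Gqw; split=> // _; exact: Gq.
  have nQ : ~ Q q.
    move=> Qq; have : {ae P, forall w : Om, False} by apply: filterS2 Qq nGq => w.
    move=> [A [mA A0 subA]].
    have AT : A = setT by apply/seteqP; split => // w _; apply: subA.
    by move: A0; rewrite AT probability_setT => -[] /eqP; rewrite oner_eq0.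
  by move: nGq; apply: filterS => w nGw; split=> [/nQ|/nGw].
apply: filterS2 P_regular => w rw wQ'.
have wQ (q : rat) : Q q <-> bounded_growth L (ratr q) w.
  by move: (wQ' (pickle q)); rewrite pickleK.
have lub : ubound (lyapunov_values L w) l.
  move=> _ [x0 x00 <-]; apply: le_ereal_inf_tmp => _ [q Qq <-].
  by apply: lambda_rc_le => //; exact/wQ.
split => //; first exact: regular_Omega0.
have val j : lyapunov_values L w (lambda_rc L w (delta_mx j 0%R)).
  exists (delta_mx j 0) => //=.
  apply/eqP => /matrixP/(_ j 0); rewrite !mxE !eqxx => /eqP.
  by rewrite oner_eq0.
pose j0 := Ordinal D_gt0.
pose lam (j : 'I_D) := lambda_rc L w (delta_mx j 0%R).
have [j1 j1max] : exists j1, forall j, (lam j <= lam j1)%E.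
  case: (@arg_maxP _ _ _ j0 predT lam isT) => j1 _ H.
  by exists j1 => j; exact: H.
(* If all basis vectors had exponents below [l], a rational strictly between would be an admissible
   rate smaller than the infimum. *)
have := lub _ (val j1); rewrite le_eqVlt => /predU1P[<-|]; first exact: val.
move=> /ereal_rat_between[q [lq ql]].
have : bounded_growth L (ratr q) w.
  have ltq j : (lam j < (ratr q)%:E)%E by exact: le_lt_trans (j1max j) lq.
  exact: bounded_growth_lambda_rc rw ltq.
by move/wQ/lQ; rewrite leNgt ql.
Qed.

End maximal_exponent.

(** * The closed loop *)

Section closed_loop_blocks.
Context {R : realType} {n : nat} {d m : 'I_n -> nat}.
Variables (A : forall i, 'M[R]_(d i)) (B : forall i, 'M[R]_(d i, m i)).
Variable K : forall i, 'M[R]_(m i, d i).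

Definition block_dynamics (j i : 'I_n) : 'M[R]_(d j) :=
  if i == j then A j + B j *m K j else A j.

Lemma block_proj_closed_loop j i :
  block_proj j *m closed_loop A B K i = block_dynamics j i *m block_proj j.
Proof.
rewrite /block_proj submxcol_mul mul1mx /closed_loop submxcolD.
have -> : \mxdiag_(j < n) A j = \mxcol_j (A j *m submxcol 1%:M j).
  by rewrite -mul_mxdiag_mxcol submxcolK mulmx1.
rewrite mxcolK -!submxcol_mul /block_column mxcolK /block_dynamics.
rewrite eq_sym; have [->|ij] := eqVneq i j.
  by rewrite conform_mx_id mulmxDl.
by rewrite !mul0mx addr0.
Qed.

Lemma block_proj_entry b (Z : 'M[R]_(\sum_(j < n) d j, b)) i k :
  exists j l, Z i k = (block_proj j *m Z) l k.
Proof.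
exists (tagnat.sig1 i), (tagnat.sig2 i).
by rewrite /block_proj submxcol_mul mul1mx -{1}(submxcolK Z) mxE.
Qed.

End closed_loop_blocks.

Section block_growth.
Context {R : realType} {N : nat} {d m : 'I_N.+1 -> nat}.
Notation Om := (Omega R N).
Variables (M : 'M[R]_N.+1) (p : 'rV[R]_N.+1).
Variables (mu : 'I_N.+1 -> probability R R) (P : probability Om R).
Hypotheses (M_stochastic : right_stochastic M) (M_irreducible : irreducible_mx M).
Hypothesis p_invariant : invariant_probability M p.
Hypothesis mu_pos : forall i, mu i `]0, +oo[%classic = 1%E.
Hypothesis mu_mean : forall i, (\int[mu i]_(t in `]0%R, +oo[) t%:E < +oo)%E.
Hypothesis P_law : switching_law M p mu P.
Variables (A : forall i, 'M[R]_(d i)) (B : forall i, 'M[R]_(d i, m i)).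
Variable K : forall i, 'M[R]_(m i, d i).

Notation L := (closed_loop A B K).
Notation T := (mean_time P).

(** The factor [(d j)%:R] belongs to the hypothesis because the max norm costs it at every sojourn;
    it must be charged to [b], since it would otherwise accumulate exponentially in n. *)
Lemma block_growth j (a b : 'I_N.+1 -> R) (l : R) :
  (forall i t, 0 <= t -> (d j)%:R * `|expmx (block_dynamics A B K j i) t| <=
    expR (a i * t + b i)) ->
  \sum_i ((a i - l) * T i + b i * p 0 i) < 0 ->
  {ae P, forall w : Om, exists C : R, forall n r, 0 <= r <= (w n).2 ->
    `|block_proj j *m (expmx (L (w n).1) r *m transition L w n)| <=
    C * expR (l * (switch_time w n + r))}.
Proof.
move=> ab neg.
have reg := ae_regular M_stochastic M_irreducible p_invariant mu_pos mu_mean P_law.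
have ae_filter : Filter (nbhs (almost_everywhere P)) := ae_filter_ringOfSetsType P.
have bdd := bounded_affine_birkhoff M_stochastic M_irreducible p_invariant mu_mean P_law neg.
apply: filterS2 reg bdd => w [wpos _] /(_ wpos)[C CP].
pose S n := \sum_(k < n) (a (w k).1 * (w k).2 + b (w k).1).
pose X n := block_proj j *m transition L w n.
have step n r : 0 <= r -> `|block_proj j *m (expmx (L (w n).1) r *m transition L w n)| <=
    expR (a (w n).1 * r + b (w n).1) * `|X n|.
  move=> r0; rewrite mulmxA (expmx_intertwine _ (block_proj_closed_loop A B K j (w n).1)).
  rewrite -mulmxA -/(X n) (le_trans (mx_norm_mul _ _))// mulrA ler_wpM2r//.
  exact: ab.
have Xn n : `|X n| <= `|X 0%N| * expR (S n).
  elim: n => [|n IH]; first by rewrite /S big_ord0 expR0 mulr1.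
  rewrite (le_trans (step n _ (ltW (wpos n))))//.
  have -> : S n.+1 = S n + (a (w n).1 * (w n).2 + b (w n).1) by rewrite /S big_ord_recr.
  rewrite (expRD (S n)) mulrA [leRHS]mulrC.
  by rewrite ler_wpM2l ?expR_ge0.
pose S' n := \sum_(k < n) ((a (w k).1 - l) * (w k).2 + b (w k).1).
have SE n : S n = S' n + l * switch_time w n.
  rewrite /S /S' /switch_time mulr_sumr -big_split/=.
  by apply: eq_bigr => k _; ring.
exists (`|X 0%N| * expR (`|C| + \sum_i `|b i|)) => n r /andP[r0 rn].
rewrite (le_trans (step n r r0))//.
apply: (@le_trans _ _ (expR (a (w n).1 * r + b (w n).1) * (`|X 0%N| * expR (S n)))).
  by rewrite ler_wpM2l ?expR_ge0.
rewrite mulrCA -mulrA ler_wpM2l// -!expRD ler_expR SE.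
have bn : b (w n).1 <= \sum_i `|b i|.
  by rewrite (bigD1 (w n).1)//= (le_trans (ler_norm _))// lerDl sumr_ge0.
have b0 : 0 <= \sum_i `|b i| by apply: sumr_ge0.
have Cn := ler_norm C.
have h : (a (w n).1 - l) * r + b (w n).1 + S' n <= `|C| + \sum_i `|b i|.
  (* The exponent is affine in [r]: if increasing it is bounded by its value at the end of the
     sojourn, a full Birkhoff sum, and otherwise by its value at the start. *)
  have [al|al] := leP 0 (a (w n).1 - l).
    have := CP n.+1; rewrite big_ord_recr/= -/(S' n) => h.
    have h' : (a (w n).1 - l) * r <= (a (w n).1 - l) * (w n).2 by rewrite ler_wpM2l.
    by lra.
  have h' : (a (w n).1 - l) * r <= 0 by rewrite mulr_le0_ge0// ltW.
  by have := CP n; rewrite -/(S' n) => h; lra.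
by move: h; set s := switch_time w n; lra.
Qed.

End block_growth.

(** * Choice of the gain *)

Section gains.
Context {R : realType} {N : nat}.

Lemma linear_beats_log (al be ka g0 : R) : 0 < al -> 0 <= ka ->
  exists2 g, g0 <= g & be + ka * ln g - al * g < 0.
Proof.
(* From ln (g / s) < g / s, the logarithm costs at most (ka / s) g plus a constant; this [s] makes
   ka / s at most al / 2, and [g] then beats the constant with the remaining half. *)
move=> al0 ka0; pose s := 2 * ka / al + 1.
have s0 : 0 < s by rewrite ltr_wpDl// divr_ge0 ?mulr_ge0// ltW.
pose g := `|g0| + 1 + 2 * (`|be + ka * ln s|) / al.
have g1 : 0 < g.
  by rewrite ltr_wpDr ?divr_ge0 ?mulr_ge0 ?(ltW al0)// ltr_wpDl.
exists g.
  by rewrite /g -addrA ler_wpDr ?ler_norm// addr_ge0// divr_ge0 ?mulr_ge0// ltW.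
have lng : ln g <= g / s + ln s.
  rewrite -lerBlDr -ln_div ?posrE// ltW// ln_sublinear// divr_gt0//.
have h1 : ka * ln g <= ka * (g / s) + ka * ln s by rewrite -mulrDr ler_wpM2l.
have h2 : ka * (g / s) <= al / 2 * g.
  rewrite mulrCA mulrC ler_wpM2r ?(ltW g1)// ler_pdivrMr// /s.
  rewrite mulrDr mulr1 (_ : al / 2 * (2 * ka / al) = ka); last by field; rewrite gt_eqF.
  by rewrite lerDl divr_ge0// ltW.
have h3 : be + ka * ln s < al / 2 * g.
  have : al / 2 * g = al / 2 * (`|g0| + 1) + `|be + ka * ln s|.
    by rewrite /g; field; rewrite gt_eqF.
  move=> ->; rewrite (le_lt_trans (ler_norm _))// ltrDr mulr_gt0// ?divr_gt0//.
by lra.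
Qed.

Variables (T p : 'I_N.+1 -> R).
Hypotheses (T_gt0 : forall i, 0 < T i) (p_ge0 : forall i, 0 <= p i).

(** Only the rate and the overshoot in mode [j] depend on the gain, so [linear_beats_log] applies
    with slope [T j] and logarithmic weight [k%:R * p j]. *)
Lemma exists_gain n m (A : 'M[R]_n) (B : 'M[R]_(n, m)) (j : 'I_N.+1) (l : R) :
  controllable A B ->
  exists (K : 'M[R]_(m, n)) (a b : 'I_N.+1 -> R),
    (forall i t, 0 <= t ->
      n%:R * `|expmx (if i == j then A + B *m K else A) t| <= expR (a i * t + b i)) /\
    \sum_i ((a i - l) * T i + b i * p i) < 0.
Proof.
move=> /controllable_kalman/pole_shifting[C [k [g0 [C0 g01 CP]]]].
(* Used in place of n, which may be 0, so that its logarithm can be taken. *)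
pose c : R := n%:R + 1.
have c0 : 0 < c by rewrite ltr_wpDl.
(* The part of the mean that does not involve [g]. *)
pose be := \sum_(i | i != j) ((growth A - l) * T i + ln c * p i) + (- l * T j + ln (c * C) * p j).
have ka0 : 0 <= k%:R * p j by rewrite mulr_ge0.
have [g g0g gP] := linear_beats_log be g0 (T_gt0 j) ka0.
have g1 : 0 < g by rewrite (lt_le_trans _ g0g)// (lt_le_trans _ g01).
have [K KP] := CP g g0g.
exists K, (fun i => if i == j then - g else growth A),
  (fun i => if i == j then ln (c * C * g ^+ k) else ln c); split.
  move=> i t t0.
  have nc (x : R) : 0 <= x -> n%:R * x <= c * x.
    by move=> x0; rewrite ler_wpM2r// lerDl.
  rewrite (le_trans (nc _ _))//; case: (i == j); rewrite expRD lnK ?posrE ?mulr_gt0 ?exprn_gt0//.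
    have -> : expR (- g * t) * (c * C * g ^+ k) = c * (C * g ^+ k * expR (- (g * t))).
      by rewrite mulNr; ring.
    by rewrite ler_wpM2l ?(ltW c0)// KP.
  rewrite mulrC ler_wpM2r ?(ltW c0)// (le_trans (expmx_le _ _))//.
  by rewrite ger0_norm.
rewrite (bigD1 j)//= eqxx addrC.
rewrite (eq_bigr (fun i => (growth A - l) * T i + ln c * p i)); last first.
  by move=> i /negPf ->.
rewrite lnM ?posrE ?mulr_gt0 ?exprn_gt0// lnXn// -mulr_natl.
apply: le_lt_trans gP; rewrite /be; set Z := \sum_(i < _ | _) _.
by rewrite le_eqVlt; apply/orP; left; apply/eqP; ring.
Qed.

End gains.

Theorem theorem5p1 (R : realType) (N : nat) (d m : 'I_N.+1 -> nat)
  (d_ge1 : (1 <= \sum_(i < N.+1) d i)%N)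
  (A : forall i : 'I_N.+1, 'M[R]_(d i))
  (B : forall i : 'I_N.+1, 'M[R]_(d i, m i))
  (AB_controllable : forall i, controllable (A i) (B i))
  (M : 'M[R]_N.+1) (p : 'rV[R]_N.+1)
  (M_stochastic : right_stochastic M) (M_irreducible : irreducible_mx M)
  (p_invariant : invariant_probability M p)
  (mu : 'I_N.+1 -> probability R R)
  (mu_pos : forall i, mu i `]0, +oo[%classic = 1%E)
  (mu_mean : forall i, (\int[mu i]_(t in `]0%R, +oo[) t%:E < +oo)%E)
  (P : probability (Omega R N) R)
  (P_law : switching_law M p mu P)
  (lambda : R) :
  exists K : forall i : 'I_N.+1, 'M[R]_(m i, d i),
  exists2 lambda_max : \bar R,
    is_lambda_max P (closed_loop A B K) lambda_max &
    (lambda_max <= lambda%:E)%E.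
Proof.
have reg := ae_regular M_stochastic M_irreducible p_invariant mu_pos mu_mean P_law.
have ae_filter : Filter (nbhs (almost_everywhere P)) := ae_filter_ringOfSetsType P.
have T0 := mean_time_gt0 M_stochastic M_irreducible p_invariant mu_pos mu_mean P_law.
have p0 i : 0 <= p 0 i by case: p_invariant.
(* The target rate is taken rational because [exists_lambda_max] compares the exponent with rational
   rates. *)
have [q] : exists q, ratr q \in `]lambda - 1, lambda[.
  by apply: rat_in_itvoo; rewrite ltrBlDr ltrDl.
rewrite in_itv/= => /andP[_ ql].
have gain j := cid (exists_gain T0 p0 j (ratr q) (AB_controllable j)).
pose K j := sval (gain j); exists K.
have growthK j : {ae P, forall w : Omega R N, exists C : R, forall n r, 0 <= r <= (w n).2 ->
    `|block_proj j *m (expmx (closed_loop A B K (w n).1) r *m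
        transition (closed_loop A B K) w n)| <=
    C * expR (ratr q * (switch_time w n + r))}.
  have [a [b [ab neg]]] := svalP (gain j).
  exact: (block_growth M_stochastic M_irreducible p_invariant mu_pos mu_mean P_law ab neg).
have [l lmax lq] := exists_lambda_max M_stochastic M_irreducible p_invariant P_law
  reg (closed_loop A B K) d_ge1.
exists l => //; apply: (@le_trans _ _ (ratr q)%:E); last by rewrite lee_fin ltW.
apply: lq.
have growth_all : {ae P, forall w : Omega R N, forall j, exists C : R,
    forall n r, 0 <= r <= (w n).2 ->
    `|block_proj j *m (expmx (closed_loop A B K (w n).1) r *m
        transition (closed_loop A B K) w n)| <=
    C * expR (ratr q * (switch_time w n + r))}.
  by apply: filter_forall => j; exact: growthK.
apply: filterS2 reg growth_all => w [wpos _] /choice[C CP].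
(* Every entry of the full matrix is an entry of one projected block, so the sum of the block
   constants bounds them all. *)
apply: (@bounded_growth_real _ _ _ _ _ _ (\sum_j `|C j|)) => n k k' kk'.
have /andP[u0 u1] := @frac_itv R k k' kk'.
set u := k'%:R / k.+1%:R in u0 u1 *.
apply: mx_norm_le => [|i i']; first by rewrite mulr_ge0 ?expR_ge0// sumr_ge0.
have [j [i2 ->]] := block_proj_entry
  (expmx (closed_loop A B K (w n).1) (u * (w n).2) *m transition (closed_loop A B K) w n) i i'.
rewrite (le_trans (mx_entry_le _ _ _))// (le_trans (CP j n _ _))//.
  by rewrite mulr_ge0 ?(ltW (wpos n))//= ler_piMl// ltW.
rewrite ler_wpM2r ?expR_ge0// (bigD1 j)//= (le_trans (ler_norm _))//.
by rewrite lerDl sumr_ge0.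
Qed.
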